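(* Let $t=t(n)\in[n]$, let $F=F(n,t)$ be chosen uniformly at random from the class $\mathcal F(n,t)$ of forests on vertex set $[n]$ consisting of exactly $t$ trees such that the vertices $1,\dots,t$ (the roots) lie in pairwise different trees, and let $\varepsilon>0$. Then: (i) with probability tending to $1$ as $n\to\infty$, $\Delta(F)\le\lfloor \nu(n)\rfloor+2$; (ii) if $t=o(n^{1-\delta})$ for some $\delta>0$, then with probability tending to $1$, $\lfloor \nu(n)-\varepsilon\rfloor+1\le\Delta(F)\le\lfloor \nu(n)+\varepsilon\rfloor+1$, and moreover there is a function $\omega(n)\to\infty$ such that with probability tending to $1$, $\Delta(F)-\max\{d_F(r): r\in[t]\}\ge\omega(n)$.
   Context: $[n]=\{1,\dots,n\}$; $\Delta(F)$ is the maximum degree and $d_F(r)$ the degree of $r$ in $F$; $\log$ is the natural logarithm. $\nu(n)$ is the unique positive zero of $f(x)=x\log n+x-(x+1/2)\log x-(x-1)\log n$. *)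

(* Defs.v *)
From HB Require Import structures.
From mathcomp Require Import all_boot all_order all_algebra.
From mathcomp Require Import all_classical all_reals all_analysis.
From mathcomp Require Import ring lra.

Set Implicit Arguments.
Unset Strict Implicit.
Unset Printing Implicit Defensive.

Import Order.TTheory GRing.Theory Num.Theory.
Import numFieldNormedType.Exports.

Local Open Scope classical_set_scope.
Local Open Scope ring_scope.

(* A simple graph on T is given by its edge set [E : {set {set T}}], all of
   whose members have exactly two elements. *)
Definition simple_graph (T : finType) (E : {set {set T}}) : Prop :=
  forall e, e \in E -> #|e| = 2%N.

Definition adj (T : finType) (E : {set {set T}}) : rel T :=
  fun x y => [set x; y]%SET \in E.

Definition acyclic (T : finType) (E : {set {set T}}) : Prop :=
  forall c : seq T, (2 < size c)%N -> ~ ucycle (adj E) c.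

Definition forest (T : finType) (E : {set {set T}}) : Prop :=
  simple_graph E /\ acyclic E.

Definition num_components (T : finType) (E : {set {set T}}) : nat :=
  n_comp (adj E) T.

Definition degree (T : finType) (E : {set {set T}}) (x : T) : nat :=
  #|[set y | adj E x y]%SET|.

Definition max_degree (T : finType) (E : {set {set T}}) : nat :=
  (\max_(x : T) degree E x)%N.

(* The vertices 1, ..., n are represented by 0, ..., n-1 in 'I_n; accordingly
   the roots 1, ..., t are the r : 'I_n with r < t. *)
Definition in_Fnt (n t : nat) (E : {set {set 'I_n}}) : Prop :=
  [/\ forest E,
      num_components E = t &
      forall r s : 'I_n, (r < t)%N -> (s < t)%N -> r != s ->
        ~~ connect (adj E) r s].

Definition Fnt (n t : nat) : {set {set {set 'I_n}}} :=
  [set E | `[< in_Fnt t E >]]%SET.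

Definition max_root_degree (n t : nat) (E : {set {set 'I_n}}) : nat :=
  (\max_(r : 'I_n | (r < t)%N) degree E r)%N.

Definition uniform_pr (R : realType) (T : finType) (A : {set T})
    (P : T -> Prop) : R :=
  #|[set x in A | `[< P x >]]%SET|%:R / #|A|%:R.

(* With probability tending to 1, the uniformly random F in F(n, t(n))
   satisfies P n. *)
Definition whp (R : realType) (t : nat -> nat)
    (P : forall n, {set {set 'I_n}} -> Prop) : Prop :=
  (fun n => uniform_pr R (Fnt n (t n)) (@P n)) @ \oo --> (1 : R).

Definition nu_fun (R : realType) (n : nat) (x : R) : R :=
  x * ln n%:R + x - (x + 2^-1) * ln x - (x - 1) * ln n%:R.

(* [nu_spec] below shows that this is indeed the unique positive zero. *)
Definition nu (R : realType) (n : nat) : R :=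
  xget 0 [set x | 0 < x /\ nu_fun n x = 0].

Lemma nu_funE (R : realType) n (x : R) :
  nu_fun n x = ln n%:R + x - (x + 2^-1) * ln x.
Proof. by rewrite /nu_fun; ring. Qed.

Lemma nu_fun_derive (R : realType) n (x : R) : 0 < x ->
  is_derive x 1 (@nu_fun R n) (- ln x - (2 * x)^-1).
Proof.
move=> x0.
have -> : @nu_fun R n =
    (cst (ln n%:R) + id) - (id + cst 2^-1) * (@ln R : R -> R).
  by apply/funext => z; rewrite nu_funE.
have dln := is_derive1_ln x0.
apply: is_derive_eq.
rewrite /= /GRing.scale /=.
have -> : (id + cst 2^-1) x = x + 2^-1 by [].
by field; rewrite gt_eqF.
Qed.

Lemma nu_fun_derive_lt0 (R : realType) (x : R) :
  0 < x -> - ln x - (2 * x)^-1 < 0.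
Proof.
move=> x0; have u0 : 0 < (2 * x)^-1 by rewrite invr_gt0 mulr_gt0.
have ln2 : ln (2 : R) < 1.
  rewrite -ltr_expR lnK ?posrE//.
  exact: (expR_gt1Dx (oner_neq0 R)).
have h : ln ((2 * x)^-1) <= (2 * x)^-1 - 1.
  rewrite -[X in ln X](subrKC 1) le_ln1Dx//; lra.
move: h; rewrite lnV ?posrE ?mulr_gt0// lnM ?posrE//; lra.
Qed.

Lemma nu_fun_decr (R : realType) n (x y : R) :
  0 < x -> x < y -> nu_fun n y < nu_fun n x.
Proof.
move=> x0 xy.
have pos z : z \in `[x, y]%R -> 0 < z.
  by rewrite in_itv/= => /andP[/(lt_le_trans x0)].
apply: (@ltr0_derive1_lt_cc R (@nu_fun R n) x y); rewrite ?in_itv/= ?lexx ?ltW//.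
- move=> z /subset_itv_oo_cc/pos z0; by apply: ex_derive; exact: nu_fun_derive.
- move=> z /subset_itv_oo_cc/pos z0; rewrite derive1E.
  by have [_ ->] := nu_fun_derive n z0; exact: nu_fun_derive_lt0.
- apply: derivable_within_continuous => z /pos z0.
  by apply: ex_derive; exact: nu_fun_derive.
Qed.

Lemma nu_fun_zero (R : realType) n : (0 < n)%N ->
  exists x : R, 0 < x /\ nu_fun n x = 0.
Proof.
move=> n0; have n1 : 1 <= n%:R :> R by rewrite ler1n.
have l0 : 0 <= ln (n%:R : R) by exact: ln_ge0.
pose y : R := expR 2 * n%:R.
have y1 : 1 <= y.
  by rewrite /y -[leLHS]mulr1 ler_pM// -expR0 ler_expR.
have lny : ln y = 2 + ln n%:R.
  by rewrite lnM ?posrE ?expR_gt0// ?expRK// (lt_le_trans ltr01).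
have f1 : 0 <= nu_fun n (1 : R) by rewrite nu_funE ln1; lra.
have fy : nu_fun n y <= 0 by rewrite nu_funE lny; nra.
have [||c] := @IVT R (@nu_fun R n) 1 y 0 y1.
- apply: derivable_within_continuous => z; rewrite in_itv/= => /andP[z1 _].
  by apply: ex_derive; exact: nu_fun_derive (lt_le_trans ltr01 z1).
- by rewrite ge_min le_max f1 fy orbT.
rewrite in_itv/= => /andP[c1 _] fc; exists c; split => //.
exact: lt_le_trans ltr01 c1.
Qed.

Lemma nu_spec (R : realType) n : (0 < n)%N ->
  [/\ 0 < nu R n, nu_fun n (nu R n) = 0 &
      forall x : R, 0 < x -> nu_fun n x = 0 -> x = nu R n].
Proof.
move=> n0; have [nu0 fnu] := xgetPex 0 (nu_fun_zero R n0).
split => // x x0 fx; case: (ltgtP x (nu R n)) => // h.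
- by move: (nu_fun_decr n x0 h); rewrite fx fnu ltxx.
- by move: (nu_fun_decr n nu0 h); rewrite fx fnu ltxx.
Qed.

(* Main.v *)
(** Orienting the edges towards the roots identifies a forest of F(n,t) with its
    parent map.  Giving a vertex v the weight x_v, the parent maps have total
    weight (sum of x_v over the roots) * (sum of all x_v)^(n-t-1): remove a root
    together with its set of children and induct.  Hence the numbers of children
    are distributed as n-t-1 uniform balls in n bins plus one ball in a uniform
    root; a non-root has one more neighbour than it has children.

    Extracting coefficients with the weight 1 + X at v gives binomial moments, so
    v has at least k children with probability at most 1/k! (plus 1/(t (k-1)!)
    for a root), and the union bound gives P(Delta > k) <= (n+1)/k!.  With the
    weights X, and X and Y, one gets the exact one- and two-vertex probabilities
    of having k children, and Chebyshev's inequality shows that some non-root has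
    exactly k children as soon as n/k! tends to infinity.

    Finally nu(n) solves ln n = (x + 1/2) ln x - x, the right-hand side is ln x!
    up to a bounded error, and its slope is about ln x, so n/k! passes from large
    to small around k = nu(n).  For t = o(n^(1-delta)) the same union bound over
    the roots only bounds their degrees by (1 - delta/4) nu(n). *)
Require Import Defs.
From mathcomp Require Import all_boot all_order all_algebra.
From mathcomp Require Import boolp reals.
From mathcomp Require Import ring lra zify.

Set Implicit Arguments.
Unset Strict Implicit.
Unset Printing Implicit Defensive.

Import Order.TTheory GRing.Theory Num.Theory.
Local Open Scope ring_scope.

(** * Weighted enumeration of parent maps *)

(** U holds the vertices still to be attached, S the available roots. A height decreasing along [f]
    excludes cycles, so iterating [f] from U ends in S. Fixing [f] off U makes each parent map count
    once. *)
Definition rooted_map (T : finType) (S U : {set T}) (f : {ffun T -> T}) : Prop :=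
  (forall v, v \notin U -> f v = v) /\
  exists h : T -> nat, forall v, v \in U -> f v \in S :|: U /\ (h (f v) < h v)%N.

Definition rooted_maps (T : finType) (S U : {set T}) : {set {ffun T -> T}} :=
  [set f | `[< rooted_map S U f >]].

Lemma rooted_mapsP (T : finType) (S U : {set T}) f :
  reflect (rooted_map S U f) (f \in rooted_maps S U).
Proof. by rewrite inE; exact: asboolP. Qed.

Lemma rooted_maps_set0r (T : finType) (S : {set T}) :
  rooted_maps S set0 = [set [ffun v => v]].
Proof.
apply/setP => f; rewrite [RHS]inE; apply/rooted_mapsP/eqP => [[fid _]|->].
  by apply/ffunP => v; rewrite ffunE fid// inE.
by split=> [v _|]; [rewrite ffunE | exists (fun=> 0%N) => v; rewrite inE].
Qed.

Lemma rooted_maps_set0l (T : finType) (U : {set T}) :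
  U != set0 -> rooted_maps set0 U = set0.
Proof.
case/set0Pn => u uU; apply/setP => f; rewrite [RHS]inE.
apply/negP => /rooted_mapsP[_ [h hh]].
have: forall n v, v \in U -> (n <= h v)%N.
  elim=> // n IH v /hh[]; rewrite set0U => fU; exact: leq_ltn_trans (IH _ fU).
by move=> /(_ (h u).+1 u uU); rewrite ltnn.
Qed.

(** Maps are grouped by the set C of children of s. Deleting s turns C into roots; the bijection
    overwrites the values on C, by s in one direction and by the identity in the other. *)
Lemma sum_rooted_maps_rec (R : comNzRingType) (T : finType) (x : T -> R)
    (S U : {set T}) (s : T) : s \in S -> [disjoint S & U] ->
  \sum_(f in rooted_maps S U) \prod_(u in U) x (f u) =
  \sum_(C in powerset U) x s ^+ #|C| *
    \sum_(f in rooted_maps (S :\ s :|: C) (U :\: C)) \prod_(u in U :\: C) x (f u).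
Proof.
move=> sS dSU; have sU : s \notin U by rewrite (disjointFr dSU).
rewrite (partition_big (fun f : {ffun T -> T} => [set u in U | f u == s])
  (mem (powerset U))) /=; last first.
  by move=> f _; rewrite inE; apply/fintype.subsetP => v; rewrite inE => /andP[].
apply: eq_bigr => C; rewrite inE => CU; rewrite big_distrr /=.
have UC v : v \in C -> v \in U by move=> vC; apply: (fintype.subsetP CU).
rewrite (reindex_onto (fun g : {ffun T -> T} => [ffun v => if v \in C then s else g v])
   (fun f : {ffun T -> T} => [ffun v => if v \in C then v else f v])) /=; last first.
  move=> f /andP[_ /eqP fC]; apply/ffunP => v; rewrite !ffunE.
  case: (boolP (v \in C)) => // vC.
  by move: (vC); rewrite -[in X in X -> _]fC inE => /andP[_ /eqP ->].
apply: eq_big => [g|g].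
- apply/idP/idP.
  + move=> /andP[/andP[/rooted_mapsP[fid [h hh]] /eqP fC]] /eqP gE.
    apply/rooted_mapsP; split=> [v|].
      rewrite inE negb_and negbK => /orP[vC|vU].
        by move/ffunP: gE => /(_ v); rewrite !ffunE vC.
      by have := fid v vU; rewrite ffunE; case: ifP => // /UC; rewrite (negPf vU).
    exists h => v; rewrite inE => /andP[vC vU].
    have [] := hh v vU; rewrite ffunE (negPf vC) => gv hgv; split=> //.
    have gvs : g v != s.
      by apply/negP => /eqP gvs; move: vC; rewrite -fC !inE ffunE vU gvs; case: ifP; rewrite eqxx.
    by move: gv; rewrite !inE gvs /=; case: (g v \in S) => //= ->; rewrite andbT orbN.
  + move=> /rooted_mapsP[gid [h hh]].
    have gs v : v \in U -> v \notin C -> g v != s.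
      move=> vU vC; have [] := hh v; first by rewrite inE vC.
      move=> + _; rewrite !inE; apply: contraTN => /eqP ->.
      rewrite eqxx (negPf sU) andbF /= orbF; apply/negP => /UC; exact/negP.
    apply/andP; split; [apply/andP; split|].
    * apply/rooted_mapsP; split=> [v vU|].
        rewrite ffunE; case: ifP => [/UC|_]; first by rewrite (negPf vU).
        by apply: gid; rewrite inE negb_and vU orbT.
      (* Heights are raised by one so that s, at height 0, lies below its children. *)
      exists (fun v => if v == s then 0%N else (h v).+1) => v vU; rewrite ffunE.
      have vs : v != s by apply: contraNneq sU => <-.
      case: ifP => [vC|/negbT vC]; rewrite ?eqxx (negPf vs).
        by rewrite inE sS.
      rewrite (negPf (gs _ vU vC)); have [] := hh v; first by rewrite inE vC.
      move=> gv ?; split => //; move: gv; rewrite !inE => /orP[/orP[/andP[_ ->]//|/UC->]|/andP[_ ->]];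
      by rewrite orbT.
    * apply/eqP/setP => v; rewrite !inE ffunE; case: ifP => [vC|/negbT vC].
        by rewrite UC// eqxx.
      by apply/negP => /andP[vU /eqP gvs]; move: (gs v vU vC); rewrite gvs eqxx.
    * apply/eqP/ffunP => v; rewrite !ffunE; case: (boolP (v \in C)) => vC.
        by rewrite gid// inE vC.
      by rewrite ?(negPf vC).
- move=> _.
  rewrite (bigID (mem C)) /=; congr (_ * _).
    rewrite (eq_bigr (fun=> x s)) => [|u /andP[_ uC]]; last by rewrite ffunE uC.
    rewrite prodr_const; congr (_ ^+ _); apply: eq_card => v; rewrite unfold_in /=.
    by rewrite andb_idl// => /UC.
  apply: eq_big => [v|v /andP[_ vC]]; first by rewrite !inE andbC.
  by rewrite ffunE (negPf vC).
Qed.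

Lemma sum_powerset_card (R : comNzRingType) (T : finType) (U : {set T}) (a b : R) :
  \sum_(C in powerset U) a ^+ #|C| * b ^+ #|U :\: C| = (b + a) ^+ #|U|.
Proof.
rewrite exprDn (partition_big (fun C : {set T} => inord #|C| : 'I_#|U|.+1) predT)//=.
apply: eq_bigr => k _.
rewrite (eq_bigr (fun=> b ^+ (#|U| - k) * a ^+ k)); last first.
  move=> C /andP[]; rewrite inE => CU /eqP <-.
  by rewrite inordK ?ltnS ?subset_leq_card// cardsDS// mulrC.
rewrite sumr_const; congr (_ *+ _); rewrite -cards_draws -cardsE.
congr #|pred_of_set _|; apply/setP => C; rewrite !inE unfold_in inE.
case: (boolP (C \subset U)) => //= CU.
by rewrite -val_eqE /= inordK// ltnS subset_leq_card.
Qed.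

(** After exchanging sums, each v leaves the subsets C avoiding v, and the binomial theorem applies
    on U without v. *)
Lemma sum_powerset_weight (R : comNzRingType) (T : finType) (x : T -> R)
    (U : {set T}) (a b : R) :
  \sum_(C in powerset U) a ^+ #|C| * (b ^+ #|U :\: C|.-1 * \sum_(v in U :\: C) x v) =
  (\sum_(v in U) x v) * (b + a) ^+ #|U|.-1.
Proof.
under eq_bigr do rewrite mulrA big_distrr /=.
rewrite (exchange_big_dep (mem U)) /=; last by move=> C v _; rewrite inE => /andP[].
rewrite big_distrl /=; apply: eq_bigr => v vU.
have cU : #|U :\ v| = #|U|.-1 by rewrite (cardsD1 v U) vU.
rewrite -cU -sum_powerset_card big_distrr /=; apply: eq_big => [C|C].
  rewrite !inE vU andbT subsetD1; by [].
rewrite !inE vU andbT => /andP[CU vC]; rewrite mulrC; congr (_ * (_ * _ ^+ _)).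
have -> : U :\ v :\: C = (U :\: C) :\ v by apply/setP => w; rewrite !inE andbCA.
by rewrite [#|U :\: C|](cardsD1 v) inE vC vU.
Qed.

Lemma sum_disjointU (R : nmodType) (T : finType) (A B : {set T}) (x : T -> R) :
  [disjoint A & B] ->
  \sum_(v in A :|: B) x v = \sum_(v in A) x v + \sum_(v in B) x v.
Proof.
by move=> dAB; rewrite -bigU//; apply: eq_bigl => v; rewrite !inE.
Qed.

(* The weighted Cayley formula. *)
Lemma sum_rooted_maps (R : comNzRingType) (T : finType) (x : T -> R)
    (S U : {set T}) : [disjoint S & U] -> U != set0 ->
  \sum_(f in rooted_maps S U) \prod_(u in U) x (f u) =
  (\sum_(s in S) x s) * (\sum_(v in S :|: U) x v) ^+ #|U|.-1.
Proof.
have [n] := ubnP (#|S| + #|U|); elim: n S U => // n IH S U leSU dSU U0.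
have [->|[s sS]] := set_0Vmem S.
  by rewrite rooted_maps_set0l// !big_set0 mul0r.
rewrite (sum_rooted_maps_rec x sS dSU).
have sU : s \notin U by rewrite (disjointFr dSU).
set a := x s; pose y := \sum_(v in S :\ s) x v; pose B := y + \sum_(v in U) x v.
have xS : \sum_(v in S) x v = a + y by rewrite (big_setD1 s).
have xSU : \sum_(v in S :|: U) x v = B + a.
  by rewrite sum_disjointU // xS /B; ring.
(* B is the total weight without s. The new roots weigh B minus the weight of U \ C, so the
   induction hypothesis becomes a difference of two terms; this form also covers C = U. *)
have IHC C : C \in powerset U ->
  a ^+ #|C| * (\sum_(f in rooted_maps (S :\ s :|: C) (U :\: C)) \prod_(u in U :\: C) x (f u))
  = a ^+ #|C| * B ^+ #|U :\: C|
    - a ^+ #|C| * (B ^+ #|U :\: C|.-1 * \sum_(v in U :\: C) x v).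
  rewrite inE => CU; rewrite -mulrBr; congr (_ * _).
  have [/eqP UC0|UC0] := boolP (U :\: C == set0).
    rewrite UC0 rooted_maps_set0r big_set1 big_set0 cards0 big_set0 mulr0 expr0.
    by rewrite subr0.
  have dSC : [disjoint S :\ s & C].
    by apply: disjointWl (disjointWr CU dSU); exact: subD1set.
  have dSUs : [disjoint S :\ s & U] by apply: disjointWl dSU; exact: subD1set.
  rewrite IH//; last first.
  - rewrite disjoint_sym disjoints_subset; apply/fintype.subsetP => v; rewrite !inE negb_or.
    by move=> /andP[-> vU]; rewrite (disjointFl dSU vU) andbF.
  - move: leSU; rewrite (cardsD1 s S) sS; have := cardsID C U.
    rewrite (setIidPr CU); have := (leq_card_setU (S :\ s) C).1; lia.
  have -> : S :\ s :|: C :|: (U :\: C) = S :\ s :|: U.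
    apply/setP => v; rewrite !inE; case: (boolP (v \in C)) => /= [vC|_].
      by rewrite (fintype.subsetP CU)// !orbT.
    by rewrite orbF.
  rewrite (sum_disjointU _ dSC) (sum_disjointU _ dSUs) -/y -/B.
  have : #|U :\: C| != 0%N by rewrite cards_eq0.
  case: (#|_|) => // m _ /=; rewrite exprS [X in _ - X]mulrC -mulrBl; congr (_ * _).
  rewrite /B [X in _ + X - _](big_setID C) /= (setIidPr CU); ring.
(* Summing over C gives (B + a)^|U| minus the weight of U times (B + a)^(|U| - 1), and B + a minus
   the weight of U is the weight of S. *)
rewrite (eq_bigr _ IHC) sumrB sum_powerset_card sum_powerset_weight xSU xS.
have : #|U| != 0%N by rewrite cards_eq0.
case: (#|_|) => // m _ /=; rewrite exprS -mulrBl; congr (_ * _).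
by rewrite /B; ring.
Qed.

(** * Forests as parent maps *)

Definition map_edges (T : finType) (S : {set T}) (f : {ffun T -> T}) :
  {set {set T}} := [set [set v; f v] | v in ~: S].

(** The analogue of [in_Fnt] for an arbitrary vertex type and root set. *)
Definition rooted_forest (T : finType) (S : {set T}) (E : {set {set T}}) : Prop :=
  [/\ forest E, num_components E = #|S| &
      forall r s : T, r \in S -> s \in S -> r != s -> ~~ connect (adj E) r s].

Definition is_height (T : finType) (S : {set T}) (f : {ffun T -> T})
    (h : T -> nat) : Prop :=
  (forall v, v \in S -> f v = v) /\ (forall v, v \notin S -> (h (f v) < h v)%N).

Lemma rooted_mapsC (T : finType) (S : {set T}) (f : {ffun T -> T}) :
  f \in rooted_maps S (~: S) <-> exists h, is_height S f h.
Proof.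
split=> [/rooted_mapsP[fid [h hh]]|[h [fid hh]]].
  exists h; split=> v; first by move=> vS; apply: fid; rewrite inE negbK.
  by move=> vS; have [|//] := hh v; rewrite inE.
apply/rooted_mapsP; split=> [v|]; first by rewrite inE negbK; exact: fid.
by exists h => v; rewrite setUCr inE in_setT => vS; split => //; exact: hh.
Qed.

Lemma eq_set2 (T : finType) (x y v w : T) :
  [set x; y] = [set v; w] -> x = v /\ y = w \/ x = w /\ y = v.
Proof.
move=> /setP e; have := e x; have := e y; have := e v; have := e w.
rewrite !inE !eqxx !orbT /= => hw hv /esym hy /esym hx.
case/orP: hx => /eqP xE; case/orP: hy => /eqP yE; subst; auto.
  by left; move: hw; rewrite orbb => /eqP->.
by right; move: hv; rewrite orbb => /eqP->.
Qed.

Lemma adj_map_edges (T : finType) (S : {set T}) (f : {ffun T -> T}) x y :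
  adj (map_edges S f) x y =
  (x \notin S) && (f x == y) || (y \notin S) && (f y == x).
Proof.
apply/imsetP/idP => [[v]|].
  rewrite inE => vS /eq_set2[] [-> ->]; first by rewrite vS eqxx.
  by rewrite vS eqxx orbT.
move=> /orP[] /andP[vS /eqP <-]; [exists x | exists y]; rewrite ?inE//.
by rewrite setUC.
Qed.

Lemma adj_sym (T : finType) (E : {set {set T}}) : symmetric (adj E).
Proof. by move=> x y; rewrite /adj setUC. Qed.

Lemma iter_root (T : finType) (S : {set T}) f h : is_height S f h ->
  forall k v, (h v <= k)%N -> iter k f v \in S.
Proof.
move=> [fid hh]; elim=> [|k IH] v hv.
  by rewrite /= -[_ \in _]negbK; apply/negP => /hh; lia.
rewrite iterSr; case: (boolP (v \in S)) => vS; last by apply: IH; have := hh v vS; lia.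
by rewrite fid//; elim: k {IH hv} => //= k IH; rewrite fid.
Qed.

(** Iterating [f] as often as the largest height sends each vertex to the root of its tree. As roots
    are fixed, this retraction is constant along edges, hence separates the components of different
    roots. *)
Lemma map_edges_root (T : finType) (S : {set T}) f h : is_height S f h ->
  exists rt : T -> T, [/\ forall v, rt v \in S,
    forall v, v \in S -> rt v = v,
    forall v, connect (adj (map_edges S f)) v (rt v) &
    forall u v, connect (adj (map_edges S f)) u v -> rt u = rt v].
Proof.
move=> ht; have [fid hh] := ht; pose K := \max_(v : T) h v.
have hK v : (h v <= K)%N by apply: leq_bigmax.
have rS v : iter K f v \in S by exact: (iter_root ht).
have rf v : iter K f (f v) = iter K f v by rewrite -iterSr iterS fid.
exists (iter K f); split => //.
- by move=> v vS; elim: K {hK rS rf} => //= k ->; rewrite fid.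
- move=> v; elim: K {hK rS rf} => [|k IH]; first exact: connect0.
  apply: connect_trans IH _; rewrite iterS; set w := iter k f v.
  case: (boolP (w \in S)) => wS; first by rewrite fid// connect0.
  by apply: connect1; rewrite adj_map_edges wS eqxx.
- move=> u v /connectP[p + ->]; elim: p u => //= w p IH u /andP[auw /IH <-].
  by move: auw; rewrite adj_map_edges => /orP[] /andP[_ /eqP <-]; rewrite rf.
Qed.

(* A vertex of maximal height on a cycle would have both of its neighbours
   equal to its image. *)
Lemma map_edges_acyclic (T : finType) (S : {set T}) f h : is_height S f h ->
  acyclic (map_edges S f).
Proof.
move=> [fid hh] c sc /andP[cyc uc].
have [x0 x0c] : exists x, x \in c by case: c sc {cyc uc} => // x c _; exists x; rewrite inE eqxx.
have := @arg_maxnP _ x0 (mem c) h x0c.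
case=> v vc vmax.
have nb w : w \in c -> adj (map_edges S f) v w -> w = f v.
  move=> wc; rewrite adj_map_edges => /orP[] /andP[wS /eqP]; first by [].
  by move=> fw; have := hh w wS; rewrite fw; have := vmax w wc; rewrite /=; lia.
have n1 : next c v = f v by apply: nb; [rewrite mem_next | exact: next_cycle].
have n2 : prev c v = f v.
  by apply: nb; [rewrite mem_prev | rewrite adj_sym; exact: prev_cycle].
case: (rot_to vc) => i c' ec.
have uc' : uniq (v :: c') by rewrite -ec rot_uniq.
have sc' : (2 < size (v :: c'))%N by rewrite -ec size_rot.
have e1 : next (v :: c') v = f v by rewrite -ec next_rot.
have e2 : prev (v :: c') v = f v by rewrite -ec prev_rot.
(* On a cycle v, a, b, ... the successor of v is a, while its predecessor is the last vertex; the
   induction along [c'] shows that these differ. *)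
case: c' uc' sc' e1 e2 {ec} => [|a [|b c']] //= uc' _.
rewrite eqxx => <-.
move: uc'; rewrite !inE !negb_or -!andbA. move=> /and5P[va vb vc' ab /andP[ac' _]].
rewrite (negPf va) (negPf vb) => e; move: ab ac'; rewrite -{}e.
elim: c' b vc' vb => [|d c' IH] b /=; first by move=> _ _; rewrite !eqxx.
rewrite !inE negb_or => /andP[vd vc'] vb; rewrite (negPf vd).
by move=> ?; rewrite negb_or => /andP[? ?]; apply: (IH d).
Qed.

Lemma map_edges_simple (T : finType) (S : {set T}) f h : is_height S f h ->
  simple_graph (map_edges S f).
Proof.
move=> [_ hh] e /imsetP[v]; rewrite inE => vS ->; rewrite cards2.
by case: eqP => // fv; have := hh v vS; rewrite -fv ltnn.
Qed.

Lemma map_edges_rooted_forest (T : finType) (S : {set T}) f :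
  f \in rooted_maps S (~: S) -> rooted_forest S (map_edges S f).
Proof.
move=> /rooted_mapsC[h ht]; split.
- by split; [exact: map_edges_simple ht | exact: map_edges_acyclic ht].
- have [rt [rtS rtid rtc rte]] := map_edges_root ht.
  rewrite /num_components; set e := adj _; have esym : connect_sym e by apply: sym_connect_sym; exact: adj_sym.
  have inj : {in S &, injective (fingraph.root e)}.
    by move=> r s rS sS /eqP; rewrite root_connect// => /rte; rewrite !rtid.
  rewrite /n_comp_mem -(card_in_imset inj); apply: eq_card => v.
  rewrite !inE andbT; apply/eqP/imsetP => [vr|[r rS ->]]; last exact: root_root.
  by exists (rt v) => //; rewrite -{1}vr; apply/eqP; rewrite root_connect// rtc.
- move=> r s rS sS; apply: contra => rs.
  have [rt [_ rtid _ /(_ _ _ rs)]] := map_edges_root ht.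
  by rewrite !rtid// => ->.
Qed.

(** Induction on height: the edge from v to [f v] in the graph of [g] either gives [g v = f v], or
    [g (f v) = v]; the latter yields [f (f v) = v] by induction, against the heights. *)
Lemma map_edges_inj (T : finType) (S : {set T}) :
  {in rooted_maps S (~: S) &, injective (map_edges S)}.
Proof.
move=> f g /rooted_mapsC[h [fid hh]] /rooted_mapsC[h' [gid _]] E.
apply/ffunP => v; have [n] := ubnP (h v); elim: n v => // n IH v hv.
case: (boolP (v \in S)) => vS; first by rewrite fid// gid.
have : adj (map_edges S g) v (f v) by rewrite -E adj_map_edges vS eqxx.
rewrite adj_map_edges => /orP[/andP[_ /eqP->]//|/andP[fvS /eqP gfv]].
have hfv := hh v vS; have hffv := hh _ fvS.
by move: hffv; rewrite IH ?gfv; lia.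
Qed.

(** Each vertex is sent to a neighbour closer to S. The resulting forest lies inside E and spans the
    same components, so a further edge of E would close a cycle. *)
Lemma rooted_forest_map_edges (T : finType) (S : {set T}) E :
  rooted_forest S E -> exists2 f, f \in rooted_maps S (~: S) & E = map_edges S f.
Proof.
move=> [[Es Ea] Ec Ed]; rewrite /num_components in Ec; set e := adj E in Ec Ed.
have esym : connect_sym e by apply: sym_connect_sym; exact: adj_sym.
have inj : {in S &, injective (fingraph.root e)}.
  move=> r s rS sS /eqP; rewrite root_connect// => rs.
  by apply/eqP; apply: contraTT rs => rs; apply: Ed.
(* Roots lie in different components and there are as many components as roots, so every component
   contains one. *)
have surj v : exists2 r, r \in S & connect e v r.
  have sub : fingraph.root e @: S \subset [set x | roots e x].
    by apply/fintype.subsetP => x /imsetP[r _ ->]; rewrite inE; exact: roots_root.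
  have : fingraph.root e @: S == [set x | roots e x].
    rewrite eqEcard sub (card_in_imset inj) -Ec /n_comp_mem.
    by apply: subset_leq_card; apply/fintype.subsetP => x; rewrite !inE andbT.
  move/eqP/setP/(_ (fingraph.root e v)); rewrite inE (roots_root esym) => /imsetP[r rS rv].
  by exists r => //; rewrite -root_connect//; apply/eqP.
pose P v i := [exists p : i.-tuple T, path e v p && (last v p \in S)].
have Pex v : exists i, P v i.
  have [r rS /connectP[p pp er]] := surj v.
  by exists (size p); apply/existsP; exists (in_tuple p); rewrite pp -er rS.
pose h v := ex_minn (Pex v).
have hP v : v \notin S -> exists2 w, e v w & (h w < h v)%N.
  move=> vS; rewrite {2}/h; case: ex_minnP => i /existsP[p /andP[pp pl]] _.
  case: p pp pl => [[|w p]] /= sp; first by rewrite (negPf vS).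
  move=> /andP[vw pp] pl; exists w => //; rewrite /h; case: ex_minnP => j _.
  move=> /(_ (size p)) jp; rewrite -(eqP sp) /= ltnS; apply: jp.
  by apply/existsP; exists (in_tuple p); rewrite pp pl.
(* By [hP] the default v of the choice is never taken outside S. *)
pose f := [ffun v => if v \in S then v else odflt v [pick w | e v w && (h w < h v)%N]].
have fE v : v \notin S -> e v (f v) && (h (f v) < h v)%N.
  move=> vS; rewrite ffunE (negPf vS); case: pickP => [w //|nw].
  by have [w vw hw] := hP v vS; have := nw w; rewrite vw hw.
have ht : is_height S f h.
  split=> v vS; first by rewrite ffunE vS.
  by have /andP[] := fE v vS.
exists f; first by apply/rooted_mapsC; exists h.
have sub u v : adj (map_edges S f) u v -> e u v.
  rewrite adj_map_edges => /orP[] /andP[uS /eqP <-]; have /andP[] := fE _ uS => //.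
  by rewrite /e adj_sym.
have [rt [rtS rtid rtc _]] := map_edges_root ht.
have subc u v : connect (adj (map_edges S f)) u v -> connect e u v.
  by apply: connect_sub => {}u {}v /sub; exact: connect1.
apply/eqP; rewrite finset.eqEsubset; apply/andP; split; last first.
  apply/fintype.subsetP => _ /imsetP[v + ->]; rewrite inE => /fE /andP[+ _].
  by [].
apply/fintype.subsetP => xy xyE; have xy2 := Es xy xyE.
have [u [v [uv exy]]] := cards2P _ (introT eqP xy2).
have euv : e u v by rewrite /e /adj -exy.
suff : adj (map_edges S f) u v by rewrite /adj -exy.
apply/negPn/negP => nuv.
(* Otherwise a simple path of the spanning forest from u to v closes up to a cycle. *)
have cuv : connect (adj (map_edges S f)) u v.
  have : rt u = rt v.
    apply: inj => //; apply/eqP; rewrite root_connect//.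
    apply: (connect_trans (y := u)); first by rewrite esym; exact/subc/rtc.
    by apply: (connect_trans (y := v)); [exact: connect1 | exact/subc/rtc].
  move=> rtuv; apply: connect_trans (rtc u) _; rewrite rtuv.
  rewrite (sym_connect_sym (@adj_sym _ _)); exact: rtc.
move: cuv => /connectP[p0 pp0 lp0]; case/shortenP: pp0 lp0 => p pp up _ lp.
apply: (Ea (u :: p)).
  case: p pp lp {up} => [|a [|b p]] //= + lp; first by rewrite lp eqxx in uv.
  by rewrite andbT -lp (negPf nuv).
rewrite /ucycle up andbT /= rcons_path -lp (sub_path sub pp) /=.
by rewrite -/e /e adj_sym.
Qed.

(** Only non-roots are counted: a root is fixed by [f] and would otherwise be its own child. *)
Definition children (T : finType) (S : {set T}) (f : {ffun T -> T}) (v : T) : nat :=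
  #|[set u in ~: S | f u == v]|.

Lemma degree_map_edges (T : finType) (S : {set T}) (f : {ffun T -> T}) v :
  f \in rooted_maps S (~: S) ->
  degree (map_edges S f) v = (children S f v + (v \notin S))%N.
Proof.
move=> /rooted_mapsC[h [fid hh]]; rewrite /degree /children.
case: (boolP (v \in S)) => vS /=.
  rewrite addn0; apply: eq_card => u; rewrite !inE adj_map_edges vS.
  by [].
rewrite addnC.
have -> : [set y | adj (map_edges S f) v y] = f v |: [set u in ~: S | f u == v].
  by apply/setP => u; rewrite !inE adj_map_edges vS eq_sym.
rewrite cardsU1 !inE; case: (boolP (_ && _)) => // /andP[fvS /eqP ffv].
by have := hh _ fvS; have := hh v vS; rewrite ffv; lia.
Qed.

Lemma rooted_forests_imset (T : finType) (S : {set T}) :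
  [set E | `[< rooted_forest S E >]] = map_edges S @: rooted_maps S (~: S).
Proof.
apply/setP => E; rewrite inE; apply/asboolP/imsetP.
  by move=> /rooted_forest_map_edges[f fS ->]; exists f.
by move=> [f fS ->]; exact: map_edges_rooted_forest.
Qed.

(** * Numbers of children *)

Lemma coef_CXexp (R : comNzRingType) (a : R) m k :
  ((a%:P + 'X) ^+ m)`_k = a ^+ (m - k) *+ 'C(m, k).
Proof.
rewrite exprDn coef_sum.
under eq_bigr do rewrite coefMn -polyC_exp coefCM coefXn.
case: (ltnP m k) => [mk|km].
  rewrite bin_small// mulr0n big1// => i _.
  have -> : (k == i) = false by have := ltn_ord i; lia.
  by rewrite mulr0 mul0rn.
rewrite (bigD1 (inord k)) //= inordK ?ltnS// eqxx mulr1 big1 ?addr0// => i ik.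
have -> : (k == i) = false.
  by apply: contraNF ik => /eqP ->; rewrite inord_val.
by rewrite mulr0 mul0rn.
Qed.

Lemma prod_children (R : comNzRingType) (T : finType) (S : {set T})
    (f : {ffun T -> T}) (v : T) (z : R) :
  \prod_(u in ~: S) (if f u == v then z else 1) = z ^+ children S f v.
Proof.
rewrite -big_mkcondr /= prodr_const; congr (_ ^+ _).
by apply: eq_card => u; rewrite !inE unfold_in /= inE.
Qed.

Lemma sum_delta_weight (R : comNzRingType) (T : finType) (B : {set T}) (v : T) (z : R) :
  \sum_(w in B) (if w == v then z else 1) = #|B :\ v|%:R + z *+ (v \in B).
Proof.
rewrite -sumr_const; case: (boolP (v \in B)) => vB.
  rewrite (big_setD1 v)//= eqxx addrC; congr (_ + _).
  by apply: eq_bigr => w; rewrite !inE => /andP[/negPf->].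
rewrite addr0 (_ : B :\ v = B); last first.
  by apply/setP => w; rewrite !inE; case: eqP => // ->; rewrite (negPf vB).
by apply: eq_bigr => w wB; case: eqP => // wv; rewrite -wv wB in vB.
Qed.

Lemma card_rooted_maps (R : comNzRingType) (T : finType) (S : {set T}) :
  ~: S != set0 ->
  #|rooted_maps S (~: S)|%:R = #|S|%:R * #|T|%:R ^+ #|~: S|.-1 :> R.
Proof.
move=> U0; have dS : [disjoint S & ~: S] by rewrite disjoints_subset finset.setCK.
have := sum_rooted_maps (fun=> 1 : R) dS U0.
by rewrite /= prodr_const expr1n finset.setUCr !sumr_const cardsT.
Qed.

(** The weight is z at v and 1 elsewhere. The two factors are the generating functions of the ball
    in a uniform root and of the balls in uniform vertices. *)
Lemma gf_children (R : comNzRingType) (T : finType) (S : {set T}) (v : T) (z : R) :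
  ~: S != set0 ->
  \sum_(f in rooted_maps S (~: S)) z ^+ children S f v =
  (#|S :\ v|%:R + z *+ (v \in S)) * (#|T|.-1%:R + z) ^+ #|~: S|.-1.
Proof.
move=> U0; have dS : [disjoint S & ~: S] by rewrite disjoints_subset finset.setCK.
have := sum_rooted_maps (fun w => if w == v then z else 1 : R) dS U0.
under eq_bigr do rewrite prod_children.
rewrite finset.setUCr !sum_delta_weight in_setT mulr1n => ->; congr (_ * (_%:R + _) ^+ _).
by rewrite -cardsT (cardsD1 v setT) in_setT.
Qed.


Lemma natr_predD (R : comNzRingType) (n : nat) : (0 < n)%N ->
  n.-1%:R + (1%:P + 'X) = n%:R%:P + 'X :> {poly R}.
Proof.
by move=> n0; rewrite addrA -[in RHS](prednK n0) -natr1 polyCD polyC_natr.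
Qed.

Lemma coef_sum_expCX (R : comNzRingType) (I : finType) (A : {set I}) (c : I -> nat) k :
  (\sum_(i in A) (1%:P + 'X : {poly R}) ^+ c i)`_k = \sum_(i in A) ('C(c i, k))%:R.
Proof.
by rewrite coef_sum; apply: eq_bigr => i _; rewrite coef_CXexp expr1n.
Qed.

(** With z = 1 + X, the coefficient of X^k turns each map into a binomial coefficient of its number
    of children. *)
Lemma sum_bin_children (R : comNzRingType) (T : finType) (S : {set T}) (v : T) k :
  v \notin S ->
  \sum_(f in rooted_maps S (~: S)) ('C(children S f v, k))%:R =
  #|S|%:R * (#|T|%:R ^+ (#|~: S|.-1 - k) *+ 'C(#|~: S|.-1, k)) :> R.
Proof.
move=> vS; have U0 : ~: S != set0 by apply/set0Pn; exists v; rewrite inE.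
have T0 : (0 < #|T|)%N by apply/card_gt0P; exists v.
have := gf_children v (1%:P + 'X : {poly R}) U0.
rewrite (negPf vS) mulr0n addr0 natr_predD// => /(congr1 (fun p : {poly R} => p`_k)).
rewrite coef_sum_expCX => ->; rewrite -polyC_natr coefCM coef_CXexp.
by rewrite [in RHS](cardsD1 v S) (negPf vS).
Qed.

(** For a root the first factor becomes |S| + X, whose X contributes the second term. *)
Lemma sum_bin_children_root (R : comNzRingType) (T : finType) (S : {set T}) (v : T) k :
  v \in S -> ~: S != set0 ->
  \sum_(f in rooted_maps S (~: S)) ('C(children S f v, k.+1))%:R =
  #|S|%:R * (#|T|%:R ^+ (#|~: S|.-1 - k.+1) *+ 'C(#|~: S|.-1, k.+1))
  + #|T|%:R ^+ (#|~: S|.-1 - k) *+ 'C(#|~: S|.-1, k) :> R.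
Proof.
move=> vS U0.
have T0 : (0 < #|T|)%N by apply/card_gt0P; exists v.
have S0 : (0 < #|S|)%N by apply/card_gt0P; exists v.
have := gf_children v (1%:P + 'X : {poly R}) U0.
have -> : #|S :\ v| = #|S|.-1 by rewrite (cardsD1 v S) vS.
rewrite vS mulr1n !natr_predD// => /(congr1 (fun p : {poly R} => p`_k.+1)).
rewrite coef_sum_expCX => ->.
by rewrite mulrDl coefD coefCM coefXM /= !coef_CXexp.
Qed.

Lemma card_children_eq (R : comNzRingType) (T : finType) (S : {set T}) (v : T) k :
  v \notin S ->
  #|[set f in rooted_maps S (~: S) | children S f v == k]|%:R =
  #|S|%:R * (#|T|.-1%:R ^+ (#|~: S|.-1 - k) *+ 'C(#|~: S|.-1, k)) :> R.
Proof.
move=> vS; have U0 : ~: S != set0 by apply/set0Pn; exists v; rewrite inE.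
have := gf_children v ('X : {poly R}) U0.
rewrite (negPf vS) mulr0n addr0 => /(congr1 (fun p : {poly R} => p`_k)).
rewrite -!polyC_natr coefCM coef_CXexp.
have -> : #|S :\ v| = #|S| by rewrite [in RHS](cardsD1 v S) (negPf vS).
move=> <-; rewrite coef_sum.
under eq_bigr do rewrite coefXn.
rewrite -natr_sum -sum1dep_card -big_mkcondr /=; congr _%:R.
by apply: eq_bigl => f; rewrite eq_sym.
Qed.

Lemma card_children_eq2 (R : comNzRingType) (T : finType) (S : {set T}) (u v : T) k :
  u \notin S -> v \notin S -> u != v ->
  #|[set f in rooted_maps S (~: S) | (children S f u == k) && (children S f v == k)]|%:R =
  #|S|%:R * (#|T|.-2%:R ^+ (#|~: S|.-1 - k - k) *+ 'C(#|~: S|.-1 - k, k)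
     *+ 'C(#|~: S|.-1, k)) :> R.
Proof.
move=> uS vS uv; have U0 : ~: S != set0 by apply/set0Pn; exists v; rewrite inE.
have dS : [disjoint S & ~: S] by rewrite disjoints_subset finset.setCK.
(* Two independent variables: the inner one marks children of u, the outer one children of v. The
   outer coefficient is extracted first. *)
pose x w : {poly {poly R}} :=
  (if w == u then 'X%:P else 1) * (if w == v then 'X else 1).
have := sum_rooted_maps x dS U0.
under eq_bigr do rewrite /x big_split /= !prod_children.
have -> : \sum_(s in S) x s = #|S|%:R.
  rewrite -sumr_const; apply: eq_bigr => s sS; rewrite /x.
  case: eqP => [su|_]; first by rewrite -su sS in uS.
  by case: eqP => [sv|_]; [rewrite -sv sS in vS | rewrite mulr1].
have -> : \sum_(w in S :|: ~: S) x w = (#|T|.-2%:R%:P + 'X)%:P + 'X.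
  rewrite finset.setUCr (big_setD1 u) ?in_setT//= (big_setD1 v) /=; last by rewrite !inE eq_sym uv.
  rewrite /x !eqxx (negPf uv) eq_sym (negPf uv) mulr1 mul1r.
  rewrite (eq_bigr (fun=> 1)); last first.
    by move=> w; rewrite !inE => /and3P[/negPf-> /negPf->]; rewrite mulr1.
  rewrite sumr_const.
  have -> : #|[set: T] :\ u :\ v| = #|T|.-2.
    by rewrite -cardsT (cardsD1 u setT) (cardsD1 v (setT :\ u)) !inE eq_sym uv.
  by rewrite polyCD !polyC_natr; ring.
move=> /(congr1 (fun p : {poly {poly R}} => p`_k`_k)).
rewrite -!polyC_natr coefCM coef_CXexp coefCM coefMn coef_CXexp => <-.
rewrite !coef_sum.
under eq_bigr do rewrite -polyC_exp coefCM coefXn mulrC mulr_natl coefMn coefXn.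
under eq_bigr do rewrite -mulrnA mulnb.
rewrite -natr_sum -sum1dep_card -big_mkcondr /=; congr _%:R.
by apply: eq_bigl => f; rewrite ![k == _]eq_sym.
Qed.

(** * Tail bounds from binomial moments, and the second moment method *)

Lemma leq_binMexp n m k : (m <= n)%N -> ('C(m, k) * n ^ (m - k) * k`! <= n ^ m)%N.
Proof.
move=> mn; case: (ltnP m k) => [mk|km]; first by rewrite bin_small.
rewrite mulnAC bin_ffact -[in X in (_ <= X)%N](subnKC km) expnD leq_mul2r.
apply/orP; right; rewrite ffact_prod -[X in (_ <= _ ^ X)%N]card_ord -prod_nat_const.
by apply: leq_prod => i _; lia.
Qed.

(** Markov's inequality: the binomial coefficient is at least 1 whenever the value is at least k. *)
Lemma card_ge_le_bin (R : numDomainType) (I : finType) (A : {set I}) (c : I -> nat) k :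
  #|[set i in A | (k <= c i)%N]|%:R <= \sum_(i in A) ('C(c i, k))%:R :> R.
Proof.
rewrite -natr_sum ler_nat -sum1dep_card big_mkcondr /=; apply: leq_sum => i _.
by case: ifP => //; rewrite -bin_gt0.
Qed.

Lemma leq_cardC_pred (T : finType) (S : {set T}) : (#|~: S|.-1 <= #|T|)%N.
Proof. by apply: leq_trans (leq_pred _) _; rewrite max_card. Qed.

Lemma bin_expn_le (R : realFieldType) n m k : (m <= n)%N ->
  n%:R ^+ (m - k) *+ 'C(m, k) <= n%:R ^+ m / (k`!)%:R :> R.
Proof.
move=> mn; rewrite ler_pdivlMr ?ltr0n ?fact_gt0// -!natrX -mulr_natl -!natrM.
by rewrite ler_nat leq_binMexp.
Qed.

Lemma card_children_ge (R : realFieldType) (T : finType) (S : {set T}) (v : T) k :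
  v \notin S ->
  #|[set f in rooted_maps S (~: S) | (k <= children S f v)%N]|%:R <=
  #|rooted_maps S (~: S)|%:R / (k`!)%:R :> R.
Proof.
move=> vS; have U0 : ~: S != set0 by apply/set0Pn; exists v; rewrite inE.
apply: le_trans (card_ge_le_bin _ _ _ _) _; rewrite sum_bin_children// card_rooted_maps//.
by rewrite -mulrA ler_wpM2l// bin_expn_le// leq_cardC_pred.
Qed.

Lemma card_children_ge_root (R : realFieldType) (T : finType) (S : {set T}) (v : T) k :
  v \in S ->
  #|[set f in rooted_maps S (~: S) | (k < children S f v)%N]|%:R <=
  #|rooted_maps S (~: S)|%:R * ((k.+1`!)%:R^-1 + (#|S|%:R * (k`!)%:R)^-1) :> R.
Proof.
move=> vS; have [/eqP U0|U0] := boolP (~: S == set0).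
  rewrite (_ : [set _ in _ | _] = set0) ?cards0 ?mulr_ge0 ?addr_ge0 ?invr_ge0 ?mulr_ge0//.
  apply/setP => f; rewrite !inE; apply/negP => /andP[_].
  by rewrite /children U0 (_ : [set u in set0 | _] = set0) ?cards0//; apply/setP => u; rewrite !inE.
have S0 : #|S|%:R != 0 :> R by rewrite pnatr_eq0 -lt0n; apply/card_gt0P; exists v.
apply: le_trans (card_ge_le_bin _ _ _ _) _; rewrite sum_bin_children_root// card_rooted_maps//.
rewrite mulrDr lerD//.
  by rewrite -mulrA ler_wpM2l// bin_expn_le// leq_cardC_pred.
rewrite invfM mulrACA divff// mul1r; exact: bin_expn_le (leq_cardC_pred _).
Qed.

(** Chebyshev for Y, the number of events indexed by U that occur. Its mean is |U| N / |A|, and c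
    bounds the pair correlations, so P(Y = 0) is at most 1 / E(Y) + c - 1. *)
Lemma second_moment (R : realFieldType) (X V : finType) (A : {set X}) (U : {set V})
    (B : X -> V -> bool) (N c : R) :
  0 < N -> (0 < #|U|)%N -> (0 < #|A|)%N -> 0 <= c ->
  {in U, forall v, #|[set x in A | B x v]|%:R = N} ->
  {in U &, forall u v, u != v ->
     #|[set x in A | B x u && B x v]|%:R * #|A|%:R <= c * N ^+ 2} ->
  #|[set x in A | [forall v in U, ~~ B x v]]|%:R / #|A|%:R <=
  #|A|%:R / (#|U|%:R * N) + c - 1.
Proof.
move=> N0 U0 A0 c0 H1 H2.
have a0 : 0 < #|A|%:R :> R by rewrite ltr0n.
have q0 : 0 < #|U|%:R :> R by rewrite ltr0n.
set a := #|A|%:R in a0 H2 *; set q := #|U|%:R in q0 *.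
pose Y x : R := \sum_(v in U) (B x v)%:R.
have sY : \sum_(x in A) Y x = q * N.
  rewrite exchange_big /= /q mulr_natl -sumr_const; apply: eq_bigr => v vU.
  by rewrite -(H1 v vU) -natr_sum -sum1dep_card [in RHS]big_mkcondr.
have sY2 : a * \sum_(x in A) Y x ^+ 2 <= a * (q * N) + q ^+ 2 * (c * N ^+ 2).
  have -> : \sum_(x in A) Y x ^+ 2 =
      \sum_(u in U) \sum_(v in U) #|[set x in A | B x u && B x v]|%:R.
    under eq_bigr do rewrite expr2 /Y big_distrlr /=.
    rewrite exchange_big /=; apply: eq_bigr => u uU.
    rewrite exchange_big /=; apply: eq_bigr => v vU.
    rewrite -sum1dep_card [in RHS]big_mkcondr natr_sum; apply: eq_bigr => x _.
    by rewrite -natrM mulnb; case: (_ && _).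
  have -> : a * (q * N) + q ^+ 2 * (c * N ^+ 2) =
      \sum_(u in U) (a * N + \sum_(v in U) (c * N ^+ 2)).
    by rewrite !sumr_const -[RHS]mulr_natl -[(c * N ^+ 2) *+ _]mulr_natl -/q; ring.
  rewrite mulr_sumr; apply: ler_sum => u uU; rewrite (bigD1 u)//= mulrDr lerD//.
    by under eq_finset do rewrite andbb; rewrite H1.
  rewrite [leRHS](bigD1 u)//=; apply: ler_wpDl; first by rewrite mulr_ge0 ?exprn_ge0// ltW.
  rewrite mulr_sumr; apply: ler_sum => v /andP[vU vu].
  by rewrite mulrC H2// eq_sym.
set Z := #|[set x in A | _]|%:R.
(* Scaling Y by a = |A| makes its mean q N and avoids division; each point with Y = 0 contributes (q
   N)^2. *)
have Zle : Z * (q * N) ^+ 2 <= \sum_(x in A) (a * Y x - q * N) ^+ 2.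
  rewrite /Z mulr_natl -sumr_const big_mkcond [leRHS]big_mkcond.
  apply: ler_sum => x _; rewrite !inE; case: (x \in A) => //=.
  case: ifP => [/forall_inP nB|_]; last exact: sqr_ge0.
  rewrite /Y big1 ?mulr0 ?sub0r ?sqrrN// => v vU.
  by rewrite (negPf (nB v vU)).
have sE : \sum_(x in A) (a * Y x - q * N) ^+ 2 =
    a * (a * \sum_(x in A) Y x ^+ 2) - a * (q * N) ^+ 2.
  rewrite (eq_bigr (fun x => a ^+ 2 * Y x ^+ 2 - (2 * a * (q * N)) * Y x + (q * N) ^+ 2)).
    by rewrite big_split /= sumrB sumr_const -!mulr_sumr sY -[_ *+ #|A|]mulr_natl -/a; ring.
  by move=> x _; ring.
have qN : 0 < q * N by exact: mulr_gt0.
rewrite ler_pdivrMr// -(ler_pM2r (x := (q * N) ^+ 2)) ?exprn_gt0//.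
apply: le_trans Zle _; rewrite sE.
have -> : (a / (q * N) + c - 1) * a * (q * N) ^+ 2 =
  a * (a * (q * N) + q ^+ 2 * (c * N ^+ 2)) - a * (q * N) ^+ 2.
  by field; rewrite ?gt_eqF.
by rewrite lerD2r ler_pM2l.
Qed.

(** * Degrees in F(n,t) *)

Definition root_set (n t : nat) : {set 'I_n} := [set r : 'I_n | (r < t)%N].

Definition Fnt_maps (n t : nat) : {set {ffun 'I_n -> 'I_n}} :=
  rooted_maps (root_set n t) (~: root_set n t).

Lemma card_root_set n t : (t <= n)%N -> #|root_set n t| = t.
Proof.
move=> tn; rewrite -[RHS]card_ord -cardsT.
have inj : injective (widen_ord tn) by move=> i j /(congr1 val) /= /val_inj.
rewrite -(card_imset _ inj); apply: eq_card => r.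
rewrite inE; apply/idP/imsetP => [rt|[s _ ->]]; last exact: ltn_ord s.
by exists (Ordinal rt); [rewrite inE | apply: val_inj].
Qed.

Lemma card_setC_root_set n t : (t <= n)%N -> #|~: root_set n t| = (n - t)%N.
Proof. by move=> tn; rewrite cardsCs finset.setCK card_ord card_root_set. Qed.

Lemma Fnt_imset n t : (t <= n)%N ->
  Fnt n t = map_edges (root_set n t) @: Fnt_maps n t.
Proof.
move=> tn; rewrite -rooted_forests_imset; apply/setP => E; rewrite !inE.
apply: asbool_equiv_eq; split=> -[EF Ec Ed]; split => //.
- by rewrite card_root_set.
- by move=> r s; rewrite !inE; exact: Ed.
- by rewrite Ec card_root_set.
- by move=> r s rt st; apply: Ed; rewrite inE.
Qed.

Lemma uniform_pr_Fnt (R : realType) n t (P : {set {set 'I_n}} -> Prop) :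
  (t <= n)%N ->
  uniform_pr R (Fnt n t) P =
  #|[set f in Fnt_maps n t | `[< P (map_edges (root_set n t) f) >]]|%:R
  / #|Fnt_maps n t|%:R.
Proof.
move=> tn; rewrite /uniform_pr Fnt_imset// (card_in_imset (@map_edges_inj _ _)).
congr (_%:R / _); rewrite -(card_in_imset (f := map_edges (root_set n t))); last first.
  by move=> f g; rewrite inE => /andP[fA _]; rewrite inE => /andP[gA _]; exact: map_edges_inj.
apply: eq_card => E; rewrite inE; apply/andP/imsetP.
  by move=> [/imsetP[f fA ->] PE]; exists f => //; rewrite inE fA.
by move=> [f + ->]; rewrite inE => /andP[fA ->]; rewrite imset_f.
Qed.

Lemma card_Fnt_maps (R : comNzRingType) n t : (t < n)%N ->
  #|Fnt_maps n t|%:R = t%:R * n%:R ^+ (n - t).-1 :> R.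
Proof.
move=> tn; have tn' := ltnW tn.
rewrite card_rooted_maps ?card_setC_root_set// ?card_root_set ?card_ord//.
by rewrite -card_gt0 card_setC_root_set// subn_gt0.
Qed.

Lemma Fnt_maps_gt0 n t : (1 <= t <= n)%N -> (0 < #|Fnt_maps n t|)%N.
Proof.
move=> /andP[t1 tn]; case: (ltngtP t n) tn => // [tn _|tn _].
  have := card_Fnt_maps int tn; rewrite -natrX -natrM => /eqP; rewrite eqr_nat => /eqP ->.
  by rewrite muln_gt0 t1 expn_gt0 (leq_ltn_trans _ tn).
rewrite /Fnt_maps (_ : ~: root_set n t = set0) ?rooted_maps_set0r ?cards1//.
by apply/eqP; rewrite -cards_eq0 card_setC_root_set ?tn// subnn.
Qed.

Lemma card_union_bound (I J : finType) (A : {set I}) (D : {set J})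
    (P : I -> bool) (Q : J -> I -> bool) :
  (forall x, x \in A -> P x -> exists2 v, v \in D & Q v x) ->
  (#|[set x in A | P x]| <= \sum_(v in D) #|[set x in A | Q v x]|)%N.
Proof.
move=> PQ; rewrite -sum1dep_card big_mkcondr /=.
under [leqRHS]eq_bigr do rewrite -sum1dep_card big_mkcondr /=.
rewrite exchange_big /=; apply: leq_sum => x xA; case: ifP => // Px.
by have [v vD Qv] := PQ x xA Px; rewrite (bigD1 v)//= Qv.
Qed.

(** In the union bound every vertex costs 1/k!, and the t roots together cost an extra t / (t k!) =
    1/k!. *)
Lemma uniform_pr_max_degree (R : realType) n t k : (1 <= t <= n)%N ->
  uniform_pr R (Fnt n t) (fun F => (k < max_degree F)%N) <= n.+1%:R / (k`!)%:R.
Proof.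
move=> tn; have /andP[t1 tn'] := tn; set S := root_set n t.
have A0 : 0 < #|Fnt_maps n t|%:R :> R by rewrite ltr0n Fnt_maps_gt0.
have t0 : 0 < t%:R :> R by rewrite ltr0n.
rewrite uniform_pr_Fnt// ler_pdivrMr// mulrC.
(* Degree above k needs k + 1 children at a root but only k at a non-root, which also has a
   parent. *)
pose Q v f := if v \in S then (k < children S f v)%N else (k <= children S f v)%N.
apply: (@le_trans _ _ (\sum_(v in [set: 'I_n]) #|[set f in Fnt_maps n t | Q v f]|)%:R).
  rewrite ler_nat; apply: card_union_bound => f fA /asboolP kf.
  apply: contrapT => nex; move: kf; rewrite ltnNge => /negP; apply; apply/bigmax_leqP => v _.
  rewrite leqNgt; apply/negP => kv; apply: nex; exists v; rewrite ?in_setT// /Q.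
  by move: kv; rewrite degree_map_edges//; case: (v \in S); rewrite ?addn0 ?addn1.
have kk : (k.+1`!)%:R^-1 <= (k`!)%:R^-1 :> R.
  by rewrite lef_pV2 ?posrE ?ltr0n ?fact_gt0// ler_nat factS leq_pmull.
have -> : [set: 'I_n] = S :|: ~: S by rewrite finset.setUCr.
rewrite natr_sum sum_disjointU ?disjoints_subset ?finset.setCK//.
have cS : #|S| = t by exact: card_root_set.
apply: (@le_trans _ _ (\sum_(v in S) #|Fnt_maps n t|%:R * ((k`!)%:R^-1 + (t%:R * (k`!)%:R)^-1)
  + \sum_(v in ~: S) #|Fnt_maps n t|%:R / (k`!)%:R)).
  apply: lerD; apply: ler_sum => v vS.
    rewrite /Q vS; apply: le_trans (card_children_ge_root _ _ vS) _.
    by rewrite ler_pM2l// cS lerD2r.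
  by move: vS; rewrite inE => vS; rewrite /Q (negPf vS); exact: card_children_ge.
rewrite !sumr_const cS card_setC_root_set// -[_ *+ (n - t)]mulr_natl -[_ *+ t]mulr_natl natrB//.
rewrite -natr1 le_eqVlt; apply/orP; left; apply/eqP; field.
by rewrite !gt_eqF ?ltr0n ?fact_gt0.
Qed.

Lemma uniform_pr_max_root_degree (R : realType) n t k : (1 <= t <= n)%N ->
  uniform_pr R (Fnt n t) (fun F => (k < max_root_degree t F)%N) <=
  t%:R / (k.+1`!)%:R + (k`!)%:R^-1.
Proof.
move=> tn; have /andP[t1 tn'] := tn; set S := root_set n t.
have A0 : 0 < #|Fnt_maps n t|%:R :> R by rewrite ltr0n Fnt_maps_gt0.
have t0 : 0 < t%:R :> R by rewrite ltr0n.
have cS : #|S| = t by exact: card_root_set.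
rewrite uniform_pr_Fnt// ler_pdivrMr// mulrC.
apply: (@le_trans _ _ (\sum_(v in S) #|[set f in Fnt_maps n t | (k < children S f v)%N]|)%:R).
  rewrite ler_nat; apply: card_union_bound => f fA /asboolP kf.
  apply: contrapT => nex; move: kf; rewrite ltnNge => /negP; apply; apply/bigmax_leqP => v vt.
  rewrite leqNgt; apply/negP => kv; apply: nex.
  have vS : v \in S by rewrite inE.
  by exists v => //; move: kv; rewrite degree_map_edges// vS addn0.
rewrite natr_sum; apply: le_trans (ler_sum _ (fun v vS => card_children_ge_root _ _ vS)) _.
rewrite sumr_const cS -[_ *+ t]mulr_natl.
rewrite le_eqVlt; apply/orP; left; apply/eqP; field.
by rewrite !gt_eqF ?ltr0n ?fact_gt0.
Qed.

(** * Existence of a non-root with exactly k children *)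

Lemma expn_sub_le_ffact m k : (k <= m)%N -> ((m - k) ^ k <= m ^_ k)%N.
Proof.
move=> km; rewrite ffact_prod -[X in (_ ^ X <= _)%N]card_ord -prod_nat_const.
by apply: leq_prod => i _; have := ltn_ord i; lia.
Qed.

Lemma no_children_eq_le (R : realType) (T : finType) (S : {set T}) n t k :
  #|T| = n -> #|S| = t -> (1 <= t)%N -> (t + k + 1 < n)%N ->
  #|[set f in rooted_maps S (~: S) | [forall v in ~: S, ~~ (children S f v == k)]]|%:R
    / #|rooted_maps S (~: S)|%:R <=
  (k`!)%:R / (n - t)%:R * (n%:R / (n - t - 1 - k)%:R) ^+ k * (n%:R / n.-1%:R) ^+ n.-1
  + (n%:R / n.-1%:R) ^+ (2 * k) - 1 :> R.
Proof.
move=> cT cS t1 tkn; have tn : (t < n)%N by lia.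
have cU : #|~: S| = (n - t)%N by rewrite cardsCs finset.setCK cT cS.
have U0 : ~: S != set0 by rewrite -card_gt0 cU subn_gt0.
have A0 := card_rooted_maps R U0; rewrite cT cS cU in A0.
set m := (n - t).-1.
have km : (k <= m)%N by rewrite /m; lia.
have mn : (m <= n.-1)%N by rewrite /m; lia.
have n0 : 0 < n%:R :> R by rewrite ltr0n; lia.
have n1 : 0 < n.-1%:R :> R by rewrite ltr0n; lia.
have mk0 : 0 < (m - k)%:R :> R by rewrite ltr0n /m; lia.
have q0 : 0 < (n - t)%:R :> R by rewrite ltr0n; lia.
have t0 : 0 < t%:R :> R by rewrite ltr0n.
have kf0 : 0 < (k`!)%:R :> R by rewrite ltr0n fact_gt0.
have C0 : 0 < ('C(m, k))%:R :> R by rewrite ltr0n bin_gt0.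
pose N : R := t%:R * (n.-1%:R ^+ (m - k) *+ 'C(m, k)).
have N0 : 0 < N by rewrite mulr_gt0// pmulrn_lgt0 ?exprn_gt0// bin_gt0.
(* The correlation bound: the binomial coefficients compare in the right direction and n (n - 2) <=
   (n - 1)^2, so only 2k surplus factors n / (n - 1) remain. *)
pose c : R := (n%:R / n.-1%:R) ^+ (2 * k).
have r1 : 1 <= n%:R / n.-1%:R :> R by rewrite ler_pdivlMr// mul1r ler_nat leq_pred.
have c0 : 0 <= c by rewrite exprn_ge0// (le_trans ler01).
apply: le_trans (second_moment (N := N) (c := c) N0 _ _ _ _ _) _.
- by rewrite cU subn_gt0.
- by rewrite -(ltr0n R) A0 mulr_gt0// exprn_gt0.
- exact: c0.
- move=> v; rewrite inE => vS; by rewrite card_children_eq// cS cU cT.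
- move=> u v; rewrite !inE => uS vS uv.
  rewrite card_children_eq2// cS cU cT -/m A0 -/m.
  case: (ltnP m (k + k)) => mkk.
    rewrite (@bin_small (m - k)); last by clear -mkk km; lia.
    by rewrite mulr0n mul0rn mulr0 mul0r mulr_ge0// sqr_ge0.
  rewrite /N /c -[_ *+ 'C(m, k)]mulr_natl -[_ *+ 'C(m - k, k)]mulr_natl.
  rewrite -[n.-1%:R ^+ _ *+ _]mulr_natl.
  pose d := (m - k - k)%N; rewrite -/d.
  have -> : (m - k)%N = (d + k)%N by rewrite /d; clear -mkk km; lia.
  have mE : m = (d + k * 2)%N by rewrite /d; clear -mkk km; lia.
  rewrite {2}mE.
  have -> : t%:R * ('C(m, k)%:R * ('C(d + k, k)%:R * n.-2%:R ^+ d)) * (t%:R * n%:R ^+ (d + k * 2))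
     = (t%:R ^+ 2 * 'C(m, k)%:R * n%:R ^+ (k * 2)) * ('C(d + k, k)%:R * (n.-2%:R * n%:R) ^+ d) :> R.
    by rewrite exprD exprMn; ring.
  have -> : (n%:R / n.-1%:R) ^+ (2 * k) * (t%:R * ('C(m, k)%:R * n.-1%:R ^+ (d + k))) ^+ 2
     = (t%:R ^+ 2 * 'C(m, k)%:R * n%:R ^+ (k * 2)) * ('C(m, k)%:R * (n.-1%:R ^+ 2) ^+ d) :> R.
    rewrite expr_div_n exprD (mulnC 2 k) !(exprM _ k 2) -(exprM _ 2 d) mulnC exprM.
    by field; rewrite expf_neq0// gt_eqF.
  apply: ler_wpM2l; first by rewrite !mulr_ge0 ?exprn_ge0// ltW.
  apply: ler_pM => //; first by rewrite exprn_ge0// mulr_ge0.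
    by rewrite ler_nat leq_bin2l// mE; clear; lia.
  apply: lerXn2r; rewrite ?nnegrE ?mulr_ge0 ?exprn_ge0//.
  rewrite -natrM -natrX ler_nat -mulnn; clear -tn.
  by case: n tn => [|[|n]] //= _; nia.
rewrite -/c lerD2r lerD2r cU A0 -/m.
(* The left side is the reciprocal of the expected number of non-roots with k children. *)
have -> : t%:R * n%:R ^+ m / ((n - t)%:R * N) =
   (n - t)%:R^-1 * (n%:R ^+ k / 'C(m, k)%:R) * (n%:R / n.-1%:R) ^+ (m - k).
  rewrite /N -[_ *+ 'C(m, k)]mulr_natl -{1}(subnKC km) exprD expr_div_n.
  by field; rewrite !gt_eqF// exprn_gt0.
apply: ler_pM; rewrite ?mulr_ge0 ?exprn_ge0 ?divr_ge0 ?invr_ge0//.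
  rewrite mulrAC [X in _ <= X](_ : _ = (n - t)%:R^-1 * ((k`!)%:R * (n%:R / (n - t - 1 - k)%:R) ^+ k)); last by ring.
  rewrite ler_pM2l ?invr_gt0// subn1 -/m expr_div_n.
  rewrite ler_pdivrMr// mulrA mulrAC ler_pdivlMr ?exprn_gt0// mulrAC [leRHS]mulrC.
  rewrite ler_pM2l ?exprn_gt0// -natrX -natrM ler_nat mulnC bin_ffact.
  exact: expn_sub_le_ffact.
by rewrite ler_weXn2l//; clear -mn; lia.
Qed.

(** A non-root with exactly k children has degree k + 1, so maximum degree at most k excludes such
    vertices. *)
Lemma uniform_pr_max_degree_lower (R : realType) n t k :
  (1 <= t)%N -> (t + k + 1 < n)%N ->
  uniform_pr R (Fnt n t) (fun F => (max_degree F <= k)%N) <=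
  (k`!)%:R / (n - t)%:R * (n%:R / (n - t - 1 - k)%:R) ^+ k * (n%:R / n.-1%:R) ^+ n.-1
  + (n%:R / n.-1%:R) ^+ (2 * k) - 1.
Proof.
move=> t1 tkn; have tn : (t <= n)%N by lia.
apply: le_trans (no_children_eq_le R (card_ord n) (card_root_set tn) t1 tkn).
rewrite uniform_pr_Fnt//.
rewrite ler_pM2r ?invr_gt0 ?ltr0n ?Fnt_maps_gt0 ?t1// ler_nat.
apply: subset_leq_card; apply/fintype.subsetP => f; rewrite inE => /andP[fA /asboolP mf].
rewrite inE fA /=; apply/forall_inP => v; rewrite inE => vS; apply/negP => /eqP ck.
have : (degree (map_edges (root_set n t) f) v <= k)%N.
  by apply: leq_trans mf; exact: leq_bigmax.
by rewrite degree_map_edges// vS ck addn1 ltnn.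
Qed.

(** * Stirling's formula and the function nu *)

From mathcomp Require Import all_classical all_reals all_analysis.
Import numFieldNormedType.Exports.
Local Open Scope classical_set_scope.

Lemma is_derive_ge0_le (R : realType) (f df : R -> R) (a b : R) : a <= b ->
  (forall x, a <= x -> is_derive x 1 f (df x)) ->
  (forall x, a <= x -> 0 <= df x) -> f a <= f b.
Proof.
move=> ab fd df0.
have dx x : x \in `[a, b]%R -> derivable f x 1.
  by rewrite in_itv /= => /andP[/fd dfx _]; exact: ex_derive.
apply: (@ger0_derive1_le_cc R f a b); rewrite ?in_itv/= ?lexx ?ab//.
- by move=> x /subset_itv_oo_cc/dx.
- move=> x /subset_itv_oo_cc; rewrite in_itv /= => /andP[ax _].
  by rewrite derive1E; have [_ ->] := fd x ax; exact: df0.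
- by apply: derivable_within_continuous => x /dx.
Qed.

Lemma ln_le_subr1 (R : realType) (x : R) : 0 < x -> ln x <= x - 1.
Proof. by move=> x0; rewrite -[X in ln X](subrKC 1) le_ln1Dx//; lra. Qed.

(** Both sides agree at 1 and the difference is increasing. With the companion upper bound this
    controls the steps of Stirling's formula. *)
Lemma ln_ge_frac (R : realType) (y : R) : 1 <= y -> 2 * (y - 1) <= (y + 1) * ln y.
Proof.
move=> y1; pose f : R -> R := (id + cst 1) * (@ln R : R -> R) - cst 2 * (id - cst 1).
suff : f 1 <= f y.
  have -> : f 1 = (1 + 1) * ln 1 - 2 * (1 - 1) by [].
  have -> : f y = (y + 1) * ln y - 2 * (y - 1) by [].
  by rewrite ln1; lra.
apply: (is_derive_ge0_le y1 (df := fun x => ln x + x^-1 - 1)) => x x1.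
- have x0 : 0 < x by lra.
  have dln := is_derive1_ln x0.
  apply: is_derive_eq; rewrite /= /GRing.scale /=.
  have -> : (id + cst 1) x = x + 1 by [].
  have -> : (id - cst 1) x = x - 1 by [].
  by field; rewrite gt_eqF.
- have x0 : 0 < x by lra.
  by have := @ln_le_subr1 R x^-1; rewrite invr_gt0 lnV ?posrE// => /(_ x0); lra.
Qed.

Lemma ln_le_frac (R : realType) (y : R) : 1 <= y -> 2 * y * ln y <= y ^+ 2 - 1.
Proof.
move=> y1; pose f : R -> R := id * id - cst 2 * (id * (@ln R : R -> R)).
suff : f 1 <= f y.
  have -> : f 1 = 1 * 1 - 2 * (1 * ln 1) by [].
  have -> : f y = y * y - 2 * (y * ln y) by [].
  by rewrite ln1; lra.
apply: (is_derive_ge0_le y1 (df := fun x => 2 * (x - 1 - ln x))) => x x1.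
- have x0 : 0 < x by lra.
  have dln := is_derive1_ln x0.
  apply: is_derive_eq; rewrite /= /GRing.scale /=.
  have -> : (id * @ln R) x = x * ln x by [].
  by field; rewrite gt_eqF.
- have x0 : 0 < x by lra.
  by have := ln_le_subr1 x0; lra.
Qed.

(** Stirling's approximation of ln x! without its constant; nu(n) is the point where it equals ln
    n. *)
Definition stirling (R : realType) (x : R) : R := (x + 2^-1) * ln x - x.

(** This is ln (x / y) <= x / y - 1 multiplied by y + 1/2. It holds on both sides of x, so it serves
    for k above and below nu(n). *)
Lemma stirling_ge (R : realType) (x y : R) : 0 < x -> 0 < y ->
  (y - x) * ln x + (y - x) / (2 * y) <= stirling y - stirling x.
Proof.
move=> x0 y0; rewrite /stirling.
have := @ln_le_subr1 R (x / y); rewrite divr_gt0// ln_div ?posrE// => /(_ isT) h.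
have -> : (y + 2^-1) * ln y - y - ((x + 2^-1) * ln x - x) =
  (y + 2^-1) * (ln y - ln x - (1 - x / y)) + ((y - x) * ln x + (y - x) / (2 * y)).
  by field; rewrite gt_eqF.
by rewrite lerDr mulr_ge0//; lra.
Qed.

Lemma stirlingS (R : realType) (k : nat) :
  stirling k.+2%:R = stirling k.+1%:R + ln k.+2%:R
    + ((k.+1%:R + 2^-1) * ln (k.+2%:R / k.+1%:R) - 1) :> R.
Proof.
rewrite ln_div ?posrE ?ltr0n// /stirling -[in k.+2%:R + _]natr1 -[X in _ - X = _]natr1.
by ring.
Qed.

Lemma stirling_fact (R : realType) (k : nat) :
  stirling (k.+1%:R : R) <= ln ((k.+1`!)%:R : R) <= stirling k.+1%:R + 1.
Proof.
(* The term 1 / (4 (k + 1)) strengthens the lower bound so that the step errors telescope. *)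
suff : stirling (k.+1%:R : R) + 2^-1 + 4^-1 * k.+1%:R^-1 <= ln ((k.+1`!)%:R : R) <= stirling k.+1%:R + 1.
  move=> /andP[h ->]; rewrite andbT; apply: le_trans h; rewrite -addrA lerDl.
  by rewrite addr_ge0 ?mulr_ge0 ?invr_ge0.
elim: k => [|k /andP[IH1 IH2]].
  by rewrite /stirling factS fact0 muln1 ln1 invr1; apply/andP; split; lra.
rewrite factS natrM lnM ?posrE ?ltr0n ?fact_gt0// stirlingS.
set z := k.+2%:R / k.+1%:R.
have k0 : 0 < k.+1%:R :> R by rewrite ltr0n.
have kE : k.+2%:R = k.+1%:R + 1 :> R by rewrite natr1.
have zE : z = 1 + k.+1%:R^-1 by rewrite /z kE; field; rewrite gt_eqF.
have i0 : 0 < k.+1%:R^-1 :> R by rewrite invr_gt0.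
clearbody z; have z1 : 1 <= z by rewrite zE lerDl ltW.
have z0 : 0 < z by exact: lt_le_trans z1.
(* The lower bound on ln z makes the step error nonnegative; the upper one bounds it by a quarter of
   a difference of consecutive reciprocals. *)
have lo := ln_ge_frac z1; have up := ln_le_frac z1.
have l1 : 1 <= (k.+1%:R + 2^-1) * ln z.
  have : (2 * (z - 1)) * (k.+1%:R / 2) <= (z + 1) * ln z * (k.+1%:R / 2).
    by rewrite ler_pM2r//; lra.
  have -> : 2 * (z - 1) * (k.+1%:R / 2) = 1 by rewrite zE; field; rewrite gt_eqF.
  have e : (z + 1) * (k.+1%:R / 2) = k.+1%:R + 2^-1 by rewrite zE; field; rewrite gt_eqF.
  by rewrite mulrAC e.
have l2 : (k.+1%:R + 2^-1) * ln z - 1 <= 4^-1 * (k.+1%:R^-1 - k.+2%:R^-1).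
  have : 2 * z * ln z * ((k.+1%:R + 2^-1) / (2 * z)) <= (z ^+ 2 - 1) * ((k.+1%:R + 2^-1) / (2 * z)).
    by rewrite ler_pM2r// divr_gt0//; lra.
  rewrite (_ : 2 * z * ln z * _ = (k.+1%:R + 2^-1) * ln z); last by field; rewrite gt_eqF.
  rewrite (_ : (z ^+ 2 - 1) * _ = 1 + 4^-1 * (k.+1%:R^-1 - k.+2%:R^-1)); first by rewrite lerBlDl.
  have k1 : 0 < k.+1%:R + 1 :> R by rewrite addr_gt0.
  by rewrite zE kE; field; rewrite !gt_eqF// addr_gt0.
move: IH1 IH2 l1 l2; set a := k.+1%:R^-1; set b := k.+2%:R^-1.
set c := stirling _; set d := _ * ln z; set f := ln _; set g := ln _.
by clearbody a b c d f g => IH1 IH2 l1 l2; apply/andP; split; lra.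
Qed.

(** * Growth of nu(n) and size of n/k! near k = nu(n) *)

Lemma ln_nu (R : realType) n : (0 < n)%N -> ln (n%:R : R) = stirling (nu R n).
Proof.
move=> n0; have [_ + _] := nu_spec R n0; rewrite nu_funE /stirling => h.
by apply/eqP; rewrite -subr_eq0 -h; apply/eqP; ring.
Qed.

Lemma nu_near_ge (R : realType) (M : R) : \forall n \near \oo, M <= nu R n.
Proof.
pose M' := Num.max M 1; have M1 : 0 < M' by rewrite lt_max ltr01 orbT.
near=> n.
have n0 : (0 < n)%N by near: n; exact: nbhs_infty_gt.
have [nu0 fnu _] := nu_spec R n0.
apply: (@le_trans _ _ M'); first by rewrite le_max lexx.
rewrite leNgt; apply/negP => /(nu_fun_decr n nu0); rewrite fnu nu_funE ltNge => /negP; apply.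
rewrite (_ : _ - _ = ln n%:R - stirling M'); last by rewrite /stirling; ring.
rewrite subr_ge0 -[leLHS]expRK ler_ln ?posrE ?expR_gt0 ?ltr0n//.
by near: n; exact: nbhs_infty_ger.
Unshelve. all: by end_near. Qed.

Lemma ln_near_ge (R : realType) (M : R) : \forall n \near \oo, M <= ln (n%:R : R).
Proof.
near=> n.
have n0 : (0 < n)%N by near: n; exact: nbhs_infty_gt.
rewrite -[leLHS]expRK ler_ln ?posrE ?expR_gt0 ?ltr0n//.
by near: n; exact: nbhs_infty_ger.
Unshelve. all: by end_near. Qed.

Lemma stirling_ge_half (R : realType) (x : R) : 2 <= ln x -> 0 < x ->
  x * ln x / 2 <= stirling x.
Proof. by move=> lx x0; rewrite /stirling; nra. Qed.

Lemma nu_le_ln (R : realType) n : (0 < n)%N -> 2 <= ln (nu R n) ->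
  nu R n <= ln (n%:R : R).
Proof.
move=> n0 l2; have [nu0 _ _] := nu_spec R n0.
by rewrite ln_nu//; apply: le_trans (stirling_ge_half l2 nu0); nra.
Qed.

Lemma fact_gt0r (R : realType) k : 0 < (k`!)%:R :> R.
Proof. by rewrite ltr0n fact_gt0. Qed.

(** Since ln k! is at least [stirling k], ln (n/k!) is at most the drop of [stirling] from k to
    nu(n); the 2 absorbs n + 1. *)
Lemma ratio_fact_le (R : realType) (eps : R) n k :
  (0 < n)%N -> 1 <= nu R n -> 0 <= eps -> nu R n + eps <= k%:R ->
  n.+1%:R / (k`!)%:R <= 2 * expR (- (eps * ln (nu R n))).
Proof.
move=> n0 nu1 eps0 nuk; have [nu0 _ _] := nu_spec R n0.
have nr0 : 0 < n%:R :> R by rewrite ltr0n.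
apply: (@le_trans _ _ (2 * (n%:R / (k`!)%:R))).
  rewrite mulrA ler_pM2r ?invr_gt0 ?fact_gt0r// -natrM ler_nat; lia.
rewrite ler_pM2l// -[leLHS]lnK ?posrE ?divr_gt0 ?fact_gt0r// ler_expR.
rewrite ln_div ?posrE ?fact_gt0r// (ln_nu R n0).
case: k nuk => [|k] nuk; first by lra.
have /andP[h _] := stirling_fact R k.
have k0 : 0 < k.+1%:R :> R by rewrite ltr0n.
have := stirling_ge nu0 k0.
have : 0 <= (k.+1%:R - nu R n) / (2 * k.+1%:R) by rewrite divr_ge0//; lra.
have : eps * ln (nu R n) <= (k.+1%:R - nu R n) * ln (nu R n).
  by rewrite ler_wpM2r ?ln_ge0//; lra.
move: h; move: (ln _) (ln _) (stirling _) (stirling _) (_ / _) => a b c d e.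
set f := _ * _; set g := _ * _; clearbody f g; lra.
Qed.

(** The mirror image below nu(n); the 1 is the error of the upper Stirling bound. *)
Lemma fact_ratio_le (R : realType) (eps : R) n k :
  (0 < n)%N -> (0 < k)%N -> 0 <= eps -> k%:R <= nu R n - eps ->
  (k`!)%:R / n%:R <= expR (1 - eps * ln k%:R).
Proof.
move=> n0 k0 eps0 nuk; have [nu0 _ _] := nu_spec R n0.
have nr0 : 0 < n%:R :> R by rewrite ltr0n.
rewrite -[leLHS]lnK ?posrE ?divr_gt0 ?fact_gt0r// ler_expR.
rewrite ln_div ?posrE ?fact_gt0r// (ln_nu R n0).
case: k k0 nuk => // k _ nuk.
have /andP[_ h] := stirling_fact R k.
have k0 : 0 < k.+1%:R :> R by rewrite ltr0n.
have := stirling_ge k0 nu0.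
have : 0 <= (nu R n - k.+1%:R) / (2 * nu R n) by rewrite divr_ge0//; lra.
have : eps * ln k.+1%:R <= (nu R n - k.+1%:R) * ln k.+1%:R.
  by rewrite ler_wpM2r ?ln_ge0 ?ler1n//; lra.
move: h; set x := ln (k.+1`!)%:R; set y := ln k.+1%:R.
set a := stirling k.+1%:R; set b := stirling (nu R n); set c := eps * y.
set d := _ * y; set e := _ / _; clearbody x a b c d e; lra.
Qed.

(** * Error factors in the second moment bound *)

Lemma bernoulli_ge (R : realDomainType) (x : R) k : 0 <= x <= 1 ->
  1 - k%:R * x <= (1 - x) ^+ k.
Proof.
move=> /andP[x0 x1]; elim: k => [|k IH]; first by rewrite mul0r subr0 expr0.
rewrite exprS -natr1; apply: (@le_trans _ _ ((1 - x) * (1 - k%:R * x))).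
  have : 0 <= k%:R * x * x by rewrite !mulr_ge0.
  by move: (k%:R) => a; nra.
by rewrite ler_wpM2l// subr_ge0.
Qed.

(** Bernoulli's inequality for b / a = 1 - (a - b) / a, then inversion. *)
Lemma inv_exp_le (R : realFieldType) (a b : R) k (c : R) : 0 < b -> b <= a ->
  k%:R * (a - b) <= c * a -> c < 1 -> (a / b) ^+ k <= (1 - c)^-1.
Proof.
move=> b0 ba kc c1; have a0 : 0 < a by exact: lt_le_trans ba.
have -> : a / b = (1 - (a - b) / a)^-1 by field; rewrite !gt_eqF//; lra.
rewrite exprVn lef_pV2 ?posrE; last by rewrite subr_gt0.
  apply: le_trans (bernoulli_ge _ _).
    by rewrite lerD2l lerN2 mulrA ler_pdivrMr.
  by rewrite divr_ge0 ?subr_ge0 ?(ltW a0)//= ler_pdivrMr// mul1r gerBl ltW.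
apply: exprn_gt0; rewrite (_ : 1 - _ = b / a) ?divr_gt0//.
by field; rewrite gt_eqF.
Qed.

Lemma exp_pred_le (R : realType) n : (1 < n)%N ->
  (n%:R / n.-1%:R) ^+ n.-1 <= expR 1 :> R.
Proof.
case: n => [|[|n]] // _ /=; have n0 : 0 < n.+1%:R :> R by rewrite ltr0n.
have -> : n.+2%:R / n.+1%:R = 1 + n.+1%:R^-1 :> R.
  by rewrite -natr1; field; rewrite gt_eqF.
have -> : expR 1 = expR (n.+1%:R^-1) ^+ n.+1 :> R.
  by rewrite -expRM_natl divff ?gt_eqF.
by apply: lerXn2r; rewrite ?nnegrE ?expR_ge0 ?expR_ge1Dx// addr_ge0// invr_ge0.
Qed.

(** Here c bounds k (t + 1 + k) / n. The factors n / (n - t) and (1 - c)^-1 are each at most 2 and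
    the last power is at most e, which gives 4 e k!/n. *)
Lemma lower_bound_le (R : realType) n t k (c : R) :
  (1 <= k)%N -> 0 <= c <= 4^-1 -> (k * (t + 1 + k))%:R <= c * n%:R ->
  (k`!)%:R / (n - t)%:R * (n%:R / (n - t - 1 - k)%:R) ^+ k * (n%:R / n.-1%:R) ^+ n.-1
  + (n%:R / n.-1%:R) ^+ (2 * k) - 1 <= 4 * expR 1 * ((k`!)%:R / n%:R) + 4 * c.
Proof.
move=> k1 /andP[c0 c4] H.
have H4 : (4 * (k * (t + 1 + k)) <= n)%N.
  rewrite -(ler_nat R) natrM; have : 0 <= n%:R :> R by [].
  by move: H; move: (n%:R) ((k * _)%:R) => a b; nra.
have ltn : (4 * (t + 1 + k) <= n)%N by apply: leq_trans H4; rewrite leq_mul2l leq_pmull.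
have kn : (4 * k <= n)%N by lia.
have n0 : 0 < n%:R :> R by rewrite ltr0n; lia.
have e1 : (n%:R / (n - t - 1 - k)%:R) ^+ k <= (1 - c)^-1 :> R.
  apply: inv_exp_le; rewrite ?ltr0n ?ler_nat; try lia; try lra.
  rewrite -natrB; last by lia.
  apply: le_trans H; rewrite -natrM ler_nat leq_mul2l; apply/orP; right; lia.
have e2 : (n%:R / n.-1%:R) ^+ (2 * k) <= (1 - 2 * c)^-1 :> R.
  apply: inv_exp_le; rewrite ?ltr0n ?ler_nat; try lia; try lra.
  rewrite -natrB; last by lia.
  rewrite (_ : (n - n.-1)%N = 1%N) ?mulr1; last by lia.
  rewrite natrM -mulrA ler_pM2l//; apply: le_trans H.
  by rewrite ler_nat leq_pmulr//; lia.
have e3 : (n%:R / n.-1%:R) ^+ n.-1 <= expR 1 :> R by apply: exp_pred_le; lia.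
have e4 : (k`!)%:R / (n - t)%:R <= 2 * ((k`!)%:R / n%:R) :> R.
  rewrite mulrA ler_pdivlMr// mulrAC ler_pdivrMr ?ltr0n; last by lia.
  rewrite -!natrM ler_nat -mulnA mulnCA leq_mul2l; apply/orP; right; lia.
have c1 : (1 - c)^-1 <= 2 by rewrite -[leRHS]invrK lef_pV2 ?posrE; lra.
(* This is where c <= 1/4 is sharp: (1 + 4 c) (1 - 2 c) >= 1 exactly up to that value, for c >=
   0. *)
have c2 : (1 - 2 * c)^-1 <= 1 + 4 * c.
  rewrite -[leRHS]invrK lef_pV2 ?posrE ?invr_gt0; try lra.
  by rewrite -[leLHS]mul1r ler_pdivrMr; nra.
have f0 : 0 <= (k`!)%:R / n%:R :> R by rewrite divr_ge0.
have p1 : (k`!)%:R / (n - t)%:R * (n%:R / (n - t - 1 - k)%:R) ^+ k * (n%:R / n.-1%:R) ^+ n.-1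
   <= 2 * ((k`!)%:R / n%:R) * 2 * expR 1 :> R.
  apply: ler_pM => //; rewrite ?mulr_ge0 ?exprn_ge0 ?divr_ge0//.
  by apply: ler_pM => //; rewrite ?exprn_ge0 ?divr_ge0//; exact: le_trans c1.
apply: (@le_trans _ _ (2 * ((k`!)%:R / n%:R) * 2 * expR 1 + (1 + 4 * c) - 1)).
  by rewrite lerD2r lerD// (le_trans e2).
by rewrite le_eqVlt; apply/orP; left; apply/eqP; ring.
Qed.

(** * Uniform probabilities and convergence to 1 *)

Lemma uniform_prC (R : realType) (T : finType) (A : {set T}) (P : T -> Prop) :
  (0 < #|A|)%N -> uniform_pr R A P = 1 - uniform_pr R A (fun x => ~ P x).
Proof.
move=> A0; have a0 : #|A|%:R != 0 :> R by rewrite pnatr_eq0 -lt0n.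
rewrite /uniform_pr -[X in X - _](divff a0) -mulrBl; congr (_ / _).
rewrite -(cardsID [set x | `[< P x >]]%SET A) natrD.
rewrite (_ : A :&: _ = [set x in A | `[< P x >]])%SET; last by apply/setP => x; rewrite !inE.
rewrite (_ : A :\: _ = [set x in A | `[< ~ P x >]])%SET; first by rewrite addrK.
by apply/setP => x; rewrite !inE asbool_neg andbC.
Qed.

Lemma uniform_pr_ge0 (R : realType) (T : finType) (A : {set T}) (P : T -> Prop) :
  0 <= uniform_pr R A P.
Proof. by rewrite /uniform_pr divr_ge0. Qed.

Lemma le_uniform_pr (R : realType) (T : finType) (A : {set T}) (P Q : T -> Prop) :
  (forall x, P x -> Q x) -> uniform_pr R A P <= uniform_pr R A Q.
Proof.
move=> PQ; rewrite /uniform_pr ler_wpM2r ?invr_ge0// ler_nat.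
apply: subset_leq_card; apply/fintype.subsetP => x; rewrite !inE => /andP[-> /asboolP/PQ ?].
exact/asboolP.
Qed.

Lemma uniform_prU (R : realType) (T : finType) (A : {set T}) (P Q : T -> Prop) :
  uniform_pr R A (fun x => P x \/ Q x) <= uniform_pr R A P + uniform_pr R A Q.
Proof.
rewrite /uniform_pr -mulrDl ler_wpM2r ?invr_ge0// -natrD ler_nat.
rewrite (_ : [set x in A | `[< P x \/ Q x >]] =
  [set x in A | `[< P x >]] :|: [set x in A | `[< Q x >]])%SET.
  exact: (leq_card_setU _ _).1.
by apply/setP => x; rewrite !inE asbool_or andb_orr.
Qed.

Lemma whp_of_le (R : realType) (t : nat -> nat) P :
  (forall n, (0 < n)%N -> (1 <= t n <= n)%N) ->
  (forall e : R, 0 < e -> \forall n \near \oo,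
     uniform_pr R (Fnt n (t n)) (fun F => ~ P n F) <= e) ->
  whp R t P.
Proof.
move=> ht H; apply/cvgrPdist_le => e e0; near=> n.
have n0 : (0 < n)%N by near: n; exact: nbhs_infty_gt.
have F0 : (0 < #|Fnt n (t n)|)%N.
  have /andP[_ tn] := ht n n0.
  by rewrite Fnt_imset// (card_in_imset (@map_edges_inj _ _)) Fnt_maps_gt0// ht.
rewrite uniform_prC// subKr ger0_norm ?uniform_pr_ge0//.
by near: n; exact: H.
Unshelve. all: by end_near. Qed.

(** * Asymptotics *)

Lemma natr_absz_ge0 (R : realType) (z : int) : 0 <= z -> (`|z|%N)%:R = z%:~R :> R.
Proof. by move=> z0; rewrite -[in RHS](gez0_abs z0) -pmulrn. Qed.

(** The threshold k = floor (nu(n) + eps) + 1 exceeds nu(n) + eps, so the union bound is at most 2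
    nu(n)^(-eps), which tends to 0. *)
Lemma near_max_degree_upper (R : realType) (t : nat -> nat) (eps e : R) :
  (forall n, (0 < n)%N -> (1 <= t n <= n)%N) -> 0 < eps -> 0 < e ->
  \forall n \near \oo, uniform_pr R (Fnt n (t n)) (fun F =>
    ~ ((max_degree F)%:Z <= Num.floor (nu R n + eps) + 1)) <= e.
Proof.
move=> ht eps0 e0; near=> n.
have n0 : (0 < n)%N by near: n; exact: nbhs_infty_gt.
have nu1 : 1 <= nu R n by near: n; exact: nu_near_ge.
have nuM : expR (- ln (e / 2) / eps) <= nu R n by near: n; exact: nu_near_ge.
set z := Num.floor _ + 1.
have z0 : 0 <= z by rewrite addr_ge0// real_floor_ge0 ?num_real//; lra.
have kz : nu R n + eps <= (`|z|%N)%:R.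
  by rewrite natr_absz_ge0// ltW// floorD1_gt.
apply: (@le_trans _ _ (uniform_pr R (Fnt n (t n)) (fun F => (`|z| < max_degree F)%N))).
  by apply: le_uniform_pr => F; rewrite -(gez0_abs z0) lez_nat => /negP; rewrite -ltnNge.
apply: le_trans (uniform_pr_max_degree _ _ (ht n n0)) _.
apply: le_trans (ratio_fact_le n0 nu1 (ltW eps0) kz) _.
have -> : e = 2 * expR (ln (e / 2)) by rewrite lnK ?posrE ?divr_gt0//; field.
rewrite ler_pM2l// ler_expR lerNl [eps * _]mulrC -ler_pdivrMr//.
rewrite -[leLHS]expRK ler_ln ?posrE ?expR_gt0//; exact: lt_le_trans nu1.
Unshelve. all: by end_near. Qed.

(** The exponent is capped at 1/2 so that n^(1 - d) still dominates ln n, and the power is put in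
    exponential form. *)
Lemma littleo_powR_le (R : realType) (t : nat -> nat) (delta : R) : 0 < delta ->
  (fun n : nat => (t n)%:R : R^o) =o_\oo
     (fun n : nat => n%:R `^ (1 - delta) : R^o) ->
  exists d : R, 0 < d <= 2^-1 /\
    \forall n \near \oo, (t n)%:R <= expR ((1 - d) * ln n%:R).
Proof.
move=> delta0 /eqoP/(_ 1 ltr01) H.
exists (Num.min delta 2^-1); split.
  by rewrite lt_min delta0 ge_min lexx orbT /= invr_gt0 ltr0n.
near=> n.
have n0 : (0 < n)%N by near: n; exact: nbhs_infty_gt.
have ln0 : 0 <= ln (n%:R : R) by rewrite ln_ge0// ler1n.
have : `|(t n)%:R : R^o| <= 1 * `|n%:R `^ (1 - delta) : R^o| by near: n; exact: H.
rewrite mul1r !ger0_norm ?powR_ge0// => /le_trans; apply.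
rewrite /powR pnatr_eq0 -leqn0 leqNgt n0 /= ler_expR ler_wpM2r//.
by rewrite lerD2l lerN2 ge_min lexx.
Unshelve. all: by end_near. Qed.

Lemma near_growth (R : realType) (t : nat -> nat) (d c : R) : 0 < d <= 2^-1 -> 0 < c ->
  (\forall n \near \oo, (t n)%:R <= expR ((1 - d) * ln n%:R) :> R) ->
  \forall n \near \oo, forall k : nat, k%:R <= ln (n%:R : R) ->
    (k * (t n + 1 + k))%:R <= c * n%:R :> R.
Proof.
move=> /andP[d0 d2] c0 H; near=> n => k kn.
have n0 : (0 < n)%N by near: n; exact: nbhs_infty_gt.
have tn : (t n)%:R <= expR ((1 - d) * ln n%:R) :> R by near: n.
(* With x = ln n and exp y >= y^2 / 2, x >= 8 gives x <= exp (x / 2), and x >= 6 / (c d^2) gives 3 x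
   <= c exp (d x). *)
have x8 : 8 <= ln (n%:R : R) by near: n; exact: ln_near_ge.
have xc : 6 / (c * d ^+ 2) <= ln (n%:R : R) by near: n; exact: ln_near_ge.
have nE : n%:R = expR (ln n%:R) :> R by rewrite lnK// posrE ltr0n.
rewrite nE; move: (ln _) kn tn x8 xc {nE} => x kn tn x8 xc.
have x0 : 0 <= x by lra.
have e1 : 1 <= expR ((1 - d) * x).
  by rewrite -[leLHS]expR0 ler_expR mulr_ge0//; lra.
have e2 : x <= expR ((1 - d) * x).
  apply: (@le_trans _ _ (expR (x / 2))); last by rewrite ler_expR; nra.
  apply: le_trans (expR_ge1Dxn 1 _); last by rewrite divr_ge0.
  rewrite (_ : (2`!)%:R = 2 :> R)//; nra.
have e3 : 3 * x <= c * expR (d * x).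
  have := expR_ge1Dxn 1 (mulr_ge0 (ltW d0) x0); rewrite (_ : (2`!)%:R = 2 :> R)// => h.
  apply: (@le_trans _ _ (c * ((d * x) ^+ 2 / 2))); last by rewrite ler_pM2l//; lra.
  move: xc; rewrite ler_pdivrMr ?mulr_gt0 ?exprn_gt0// => xc.
  rewrite [leRHS](_ : _ = x * (c * d ^+ 2) * (x / 2)); last by field.
  rewrite [leLHS](_ : _ = 6 * (x / 2)); last by field.
  by rewrite ler_wpM2r//; lra.
rewrite natrM; apply: (@le_trans _ _ (x * (3 * expR ((1 - d) * x)))).
  by apply: ler_pM => //; rewrite !natrD; lra.
have -> : expR x = expR (d * x) * expR ((1 - d) * x) by rewrite -expRD; congr expR; ring.
by rewrite mulrCA !mulrA ler_pM2r ?expR_gt0.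
Unshelve. all: by end_near. Qed.

Lemma near_max_degree_lower (R : realType) (t : nat -> nat) (d eps e : R) :
  (forall n, (0 < n)%N -> (1 <= t n <= n)%N) -> 0 < eps -> 0 < e -> 0 < d <= 2^-1 ->
  (\forall n \near \oo, (t n)%:R <= expR ((1 - d) * ln n%:R) :> R) ->
  \forall n \near \oo, uniform_pr R (Fnt n (t n)) (fun F =>
    ~ (Num.floor (nu R n - eps) + 1 <= (max_degree F)%:Z)) <= e.
Proof.
move=> ht eps0 e0 d0 H.
(* The cap 1/4 is required by [lower_bound_le]; e / 8 makes its term 4 c at most e / 2. *)
pose c := Num.min 4^-1 (e / 8).
have c0 : 0 < c by rewrite lt_min invr_gt0 ltr0n divr_gt0.
have c4 : c <= 4^-1 by rewrite ge_min lexx.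
have ce : c <= e / 8 by rewrite ge_min lexx orbT.
(* If ln k >= K, then k!/n is at most e / (8 exp 1), and the other term is at most e / 2. *)
pose K := (1 - ln (e / (8 * expR 1))) / eps.
near=> n.
have n0 : (0 < n)%N by near: n; exact: nbhs_infty_gt.
have nu2 : eps + 2 <= nu R n by near: n; exact: nu_near_ge.
have nuK : expR K + eps + 1 <= nu R n by near: n; exact: nu_near_ge.
have nue : expR 2 <= nu R n by near: n; exact: nu_near_ge.
have [nu0 _ _] := nu_spec R n0.
have ln2 : 2 <= ln (nu R n) by rewrite -[leLHS]expRK ler_ln ?posrE ?expR_gt0.
have G : forall k : nat, k%:R <= ln (n%:R : R) -> (k * (t n + 1 + k))%:R <= c * n%:R :> R.
  by near: n; exact: near_growth d0 c0 H.
set z := Num.floor _.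
have z1 : 1 <= z by rewrite floor_ge_int//; lra.
have z0 : 0 <= z by exact: le_trans z1.
have /andP[zle ltz] : z%:~R <= nu R n - eps < (z + 1)%:~R by exact: floor_itv.
pose k := `|z|%N; have kE : k%:R = z%:~R :> R by exact: natr_absz_ge0.
have k1 : (1 <= k)%N by rewrite -lez_nat gez0_abs.
have knu : k%:R <= nu R n - eps by rewrite kE.
have kK : expR K <= k%:R by move: ltz; rewrite intrD -kE; lra.
have Gk : (k * (t n + 1 + k))%:R <= c * n%:R :> R.
  by apply: G; apply: le_trans knu _; apply: le_trans (nu_le_ln n0 ln2); lra.
have tkn : (t n + k + 1 < n)%N.
  have : (4 * (k * (t n + 1 + k)) <= n)%N.
    rewrite -(ler_nat R) natrM; have : 0 <= n%:R :> R by [].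
    by move: Gk; move: (n%:R) ((k * _)%:R) => a b; clear -c4; nra.
  clear -k1 n0; nia.
apply: (@le_trans _ _ (uniform_pr R (Fnt n (t n)) (fun F => (max_degree F <= k)%N))).
  apply: le_uniform_pr => F /negP; rewrite -ltNge ltzD1.
  by rewrite -(gez0_abs z0) lez_nat.
have /andP[t1 _] := ht n n0.
apply: le_trans (uniform_pr_max_degree_lower R t1 tkn) _.
have c04 : 0 <= c <= 4^-1 by rewrite ltW.
apply: le_trans (lower_bound_le k1 c04 Gk) _.
have : (k`!)%:R / n%:R <= e / (8 * expR 1) :> R.
  apply: le_trans (fact_ratio_le n0 k1 (ltW eps0) knu) _.
  have p0 : 0 < e / (8 * expR 1) by rewrite divr_gt0 ?mulr_gt0 ?expR_gt0.
  rewrite -[leRHS]lnK ?posrE// ler_expR lerBlDl -lerBlDr [eps * _]mulrC -ler_pdivrMr//.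
  by rewrite -[leLHS]expRK ler_ln ?posrE ?expR_gt0// ltr0n.
rewrite -(ler_pM2l (x := 4 * expR 1)) ?mulr_gt0 ?expR_gt0//.
rewrite [leRHS](_ : _ = e / 2); last by field; rewrite gt_eqF// expR_gt0.
by lra.
Unshelve. all: by end_near. Qed.

(** Lowering nu(n) by a fraction d/4 costs [stirling] at most (d/4) nu ln nu + d/4, and nu ln nu <=
    2 ln n. So ln (k + 1)! is at least (1 - d/2) ln n - d/4, which beats (1 - d) ln n. *)
Lemma root_ratio_le (R : realType) (d : R) n k tr :
  0 < d <= 2^-1 -> (0 < n)%N -> 2 <= ln (nu R n) ->
  (1 - d / 4) * nu R n <= k.+1%:R <= nu R n ->
  tr <= expR ((1 - d) * ln n%:R) ->
  tr / (k.+1`!)%:R <= expR (d / 4 - d / 2 * ln n%:R).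
Proof.
move=> /andP[d0 d2] n0 ln2 /andP[k1 k2] tr_le.
have [nu0 _ _] := nu_spec R n0.
apply: (@le_trans _ _ (expR ((1 - d) * ln n%:R) / (k.+1`!)%:R)).
  by rewrite ler_pM2r// invr_gt0 fact_gt0r.
rewrite -[X in _ / X]lnK ?posrE ?fact_gt0r// -expRB ler_expR (ln_nu R n0).
have /andP[h _] := stirling_fact R k.
have k0 : 0 < k.+1%:R :> R by rewrite ltr0n.
have h1 := stirling_ge nu0 k0; have h2 := stirling_ge_half ln2 nu0.
have h3 : (nu R n - k.+1%:R) / (2 * k.+1%:R) <= d / 4.
  by rewrite ler_pdivrMr ?mulr_gt0//; nra.
have h4 : (nu R n - k.+1%:R) * ln (nu R n) <= d / 4 * (nu R n * ln (nu R n)).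
  by rewrite mulrA ler_wpM2r//; lra.
have h5 : d / 4 * (nu R n * ln (nu R n)) <= d / 2 * stirling (nu R n).
  rewrite (_ : d / 4 * _ = d / 2 * (nu R n * ln (nu R n) / 2)); last by field.
  by rewrite ler_pM2l ?divr_gt0.
move: h1; rewrite -[k.+1%:R - nu R n]opprB !mulNr => h1.
move: h h1 h3 h4 h5; set a := _ / (2 * _); set b := _ * ln (nu R n).
set p := d / 4 * _; set q := stirling (nu R n); set s := stirling k.+1%:R; set l := ln _.
by clearbody a b p q s l => *; lra.
Qed.

Lemma near_max_root_degree (R : realType) (t : nat -> nat) (d e : R) :
  (forall n, (0 < n)%N -> (1 <= t n <= n)%N) -> 0 < e -> 0 < d <= 2^-1 ->
  (\forall n \near \oo, (t n)%:R <= expR ((1 - d) * ln n%:R) :> R) ->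
  \forall n \near \oo, uniform_pr R (Fnt n (t n)) (fun F =>
    ~ ((max_root_degree (t n) F)%:R < (1 - d / 4) * nu R n)) <= e.
Proof.
move=> ht e0 d0 H; have /andP[d1 d2] := d0; near=> n.
have n0 : (0 < n)%N by near: n; exact: nbhs_infty_gt.
have [nu0 _ _] := nu_spec R n0.
have nue : expR 2 <= nu R n by near: n; exact: nu_near_ge.
have ln2 : 2 <= ln (nu R n) by rewrite -[leLHS]expRK ler_ln ?posrE ?expR_gt0.
(* This leaves room for rounding (1 - d/4) nu(n) up to k + 1 without exceeding nu(n). *)
have nud : 4 / d <= nu R n by near: n; exact: nu_near_ge.
(* This forces k >= 2 / e, so the term 1/k! <= 1/k is at most e / 2. *)
have nu4 : 2 * (1 + 2 / e) <= nu R n by near: n; exact: nu_near_ge.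
have tn : (t n)%:R <= expR ((1 - d) * ln n%:R) :> R by near: n.
have lnn : (d / 4 - ln (e / 2)) / (d / 2) <= ln (n%:R : R) by near: n; exact: ln_near_ge.
have ie : 0 < 2 / e by rewrite divr_gt0.
have dnu : 4 <= d * nu R n by move: nud; rewrite ler_pdivrMr// mulrC.
set x := (1 - d / 4) * nu R n.
have xnu : nu R n / 2 <= x by rewrite /x; nra.
have x0 : 0 < x by lra.
have /andP[zlt lez] : (Num.ceil x - 1)%:~R < x <= (Num.ceil x)%:~R by exact: ceil_itv.
have z0 : 0 < Num.ceil x by rewrite ceil_gt0.
have [k kE] : exists k : nat, Num.ceil x = k.+1%:Z.
  by case: (Num.ceil x) z0 => // -[|k] // _; exists k.
rewrite kE in zlt lez; rewrite -[k.+1%:~R]pmulrn in lez.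
have kx : k%:R < x by move: zlt; rewrite intrD -[k.+1%:~R]pmulrn -natr1 addrK.
apply: (@le_trans _ _ (uniform_pr R (Fnt n (t n)) (fun F => (k < max_root_degree (t n) F)%N))).
  apply: le_uniform_pr => F /negP; rewrite -leNgt => xF.
  have : Num.ceil x <= (max_root_degree (t n) F)%:Z by rewrite ceil_le_int -pmulrn.
  by rewrite kE lez_nat.
apply: le_trans (uniform_pr_max_root_degree R k (ht n n0)) _.
have -> : e = e / 2 + e / 2 by field.
apply: lerD.
  have kk : (1 - d / 4) * nu R n <= k.+1%:R <= nu R n.
    by apply/andP; split => //; rewrite -natr1; move: kx; rewrite /x; nra.
  apply: le_trans (root_ratio_le d0 n0 ln2 kk tn) _.
  rewrite -[leRHS]lnK ?posrE ?divr_gt0// ler_expR lerBlDl -lerBlDr [d / 2 * _]mulrC -ler_pdivrMr//.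
  by rewrite divr_gt0.
rewrite -[leRHS]invrK lef_pV2 ?posrE ?fact_gt0r ?invr_gt0 ?divr_gt0// invf_div.
apply: (@le_trans _ _ k%:R); first by move: lez; rewrite -natr1; lra.
by rewrite ler_nat; case: (k) => // m; rewrite factS leq_pmulr// fact_gt0.
Unshelve. all: by end_near. Qed.

Theorem theorem6p3 (R : realType) (t : nat -> nat)
    (ht : forall n : nat, (0 < n)%N -> (1 <= t n <= n)%N)
    (eps : R) (heps : 0 < eps) :
  whp R t (fun n F =>
    (max_degree F)%:Z <= Num.floor (nu R n) + 2)
  /\
  ((exists delta : R, 0 < delta /\
      (fun n : nat => (t n)%:R : R^o) =o_\oo
        (fun n : nat => n%:R `^ (1 - delta) : R^o)) ->
   whp R t (fun n F =>
     Num.floor (nu R n - eps) + 1 <= (max_degree F)%:Z /\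
     (max_degree F)%:Z <= Num.floor (nu R n + eps) + 1)
   /\
   exists omega : nat -> R,
     omega @ \oo --> +oo /\
     whp R t (fun n F =>
       (max_degree F)%:R - (max_root_degree (t n) F)%:R >= omega n)).
Proof.
split.
  apply: whp_of_le => // e e0.
  (* Taking eps = 1 turns floor (nu(n) + 1) + 1 into floor nu(n) + 2. *)
  have := near_max_degree_upper ht ltr01 e0; apply: filterS => n.
  rewrite real_floorDrz ?num_real ?rpred1// floor1 -addrA.
  by [].
move=> [delta [delta0 /(littleo_powR_le delta0)[d [d0 H]]]].
have e20 (e : R) : 0 < e -> 0 < e / 2 by move=> e0; rewrite divr_gt0.
split.
  apply: whp_of_le => // e e0; near=> n.
  have U : uniform_pr R (Fnt n (t n)) (fun F =>
    ~ ((max_degree F)%:Z <= Num.floor (nu R n + eps) + 1)) <= e / 2.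
    by near: n; apply: near_max_degree_upper => //; exact: e20.
  have L : uniform_pr R (Fnt n (t n)) (fun F =>
    ~ (Num.floor (nu R n - eps) + 1 <= (max_degree F)%:Z)) <= e / 2.
    by near: n; apply: near_max_degree_lower d0 H => //; exact: e20.
  rewrite [leRHS](_ : _ = e / 2 + e / 2); last by field.
  apply: le_trans (lerD L U); apply: le_trans (uniform_prU _ _ _ _).
  by apply: le_uniform_pr => F /not_andP.
have /andP[d1 d2] := d0.
(* The gap between the lower bound nu(n) - eps on the maximum degree and the bound (1 - d/4) nu(n)
   on root degrees. *)
exists (fun n => d / 4 * nu R n - eps); split.
  apply/cvgryPge => A; near=> n.
  have : (A + eps) / (d / 4) <= nu R n by near: n; exact: nu_near_ge.
  by rewrite ler_pdivrMr ?divr_gt0// mulrC => h; rewrite lerBrDr.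
apply: whp_of_le => // e e0; near=> n.
have L : uniform_pr R (Fnt n (t n)) (fun F =>
  ~ (Num.floor (nu R n - eps) + 1 <= (max_degree F)%:Z)) <= e / 2.
  by near: n; apply: near_max_degree_lower d0 H => //; exact: e20.
have Q : uniform_pr R (Fnt n (t n)) (fun F =>
    ~ ((max_root_degree (t n) F)%:R < (1 - d / 4) * nu R n)) <= e / 2.
  by near: n; apply: near_max_root_degree d0 H => //; exact: e20.
rewrite [leRHS](_ : _ = e / 2 + e / 2); last by field.
apply: le_trans (lerD L Q); apply: le_trans (uniform_prU _ _ _ _).
apply: le_uniform_pr => F nF; apply/not_andP => -[lo ro]; apply: nF.
have : nu R n - eps < (max_degree F)%:R.
  apply: lt_le_trans (floorD1_gt _) _.
  by rewrite [leRHS]pmulrn ler_int.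
by move: ro; lra.
Unshelve. all: by end_near. Qed.
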